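(* Let $K \subset L$ be a Galois extension of fields with Galois group $C_2$ (the cyclic group of order $2$), of arbitrary characteristic. Then the map of $C_2$-Tambara functors $\underline{K}^c \to \underline{L}^{\mathsf{fix}}$ adjoint to the inclusion $K \to L$ is $C_2$-Tambara étale; that is, $\underline{L}^{\mathsf{fix}}$ is flat as a $\underline{K}^c$-module and $\Omega^{1,C_2}_{\underline{L}^{\mathsf{fix}}|\underline{K}^c}=0$.
   Context: Tambara functors. Let $G$ be a finite group. A $G$-Tambara functor $\underline{R}$ assigns a commutative ring $\underline{R}(X)$ to each finite $G$-set $X$ (disjoint unions are sent to products) and to each $G$-map $f\colon X \to Y$ a restriction $\underline{R}(Y)\to\underline{R}(X)$ (a ring map), a transfer $\mathsf{tr}_f\colon \underline{R}(X)\to\underline{R}(Y)$ (additive) and a norm $\mathsf{norm}_f\colon \underline{R}(X)\to\underline{R}(Y)$ (multiplicative), subject to Tambara's axioms (functoriality, base change along pullbacks, and distributivity of norms over transfers via exponential diagrams). Forgetting norms gives a commutative Green functor, i.e. a commutative monoid for the box product $\Box$ of $G$-Mackey functors. An $\underline{R}$-module is a $G$-Mackey functor with an action of this monoid. $\underline{M}\Box_{\underline{R}}\underline{N}$ is the coequalizer of $\underline{M}\Box\underline{R}\Box\underline{N}\rightrightarrows \underline{M}\Box\underline{N}$. For a map $\underline{R}\to\underline{T}$ of Tambara functors, $\underline{T}\Box_{\underline{R}}\underline{T}$ is again a Tambara functor. The functors involved. For a commutative ring $R$, the constant $C_2$-Tambara functor $\underline{R}^c$ has $\underline{R}^c(C_2/e)=\underline{R}^c(C_2/C_2)=R$,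 trivial Weyl action, $\mathsf{res}(a)=a$, $\mathsf{tr}(a)=2a$, $\mathsf{norm}(a)=a^2$. For a commutative ring $T$ with an action of $C_2=\langle\tau\rangle$, $\underline{T}^{\mathsf{fix}}$ has $\underline{T}^{\mathsf{fix}}(C_2/e)=T$, $\underline{T}^{\mathsf{fix}}(C_2/C_2)=T^{C_2}$, $\mathsf{res}$ the inclusion, $\mathsf{tr}(a)=a+\tau(a)$, $\mathsf{norm}(a)=a\tau(a)$. The functor $(-)^{\mathsf{fix}}$ is right adjoint to evaluation at $C_2/e$; the map $\underline{K}^c\to\underline{L}^{\mathsf{fix}}$ adjoint to the $C_2$-map $K\to L$ is the inclusion $K\subset L$ at $C_2/e$ and the identity $K = L^{C_2}$ at $C_2/C_2$. Étaleness. For a map $\underline{R}\to\underline{T}$ of $G$-Tambara functors let $\underline{I}=\ker(\mathsf{mult}\colon\underline{T}\Box_{\underline{R}}\underline{T}\to\underline{T})$. Let $\underline{I}^{>1}$ be the ideal of $\underline{T}\Box_{\underline{R}}\underline{T}$ generated by all $\mathsf{norm}_f(x)$ with $x\in\underline{I}(X)$ and $f\colon X\to Y$ a $2$-surjective map of finite $G$-sets (every fibre of $f$ has at least two elements); it contains $\underline{I}^2$. The $G$-Tambara Kähler differentials are $\Omega^{1,G}_{\underline{T}|\underline{R}}=\underline{I}/\underline{I}^{>1}$. The map $\underline{R}\to\underline{T}$ is $G$-Tambara étale if $\underline{T}$ is flat over $\underline{R}$ (i.e. $\underline{T}\Box_{\underline{R}}(-)$ is exact on $\underline{R}$-modules)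 and $\Omega^{1,G}_{\underline{T}|\underline{R}}=0$. *)

(* Defs.v *)
From HB Require Import structures.
From mathcomp Require Import all_boot all_order all_algebra all_fingroup.
From mathcomp Require Import all_solvable all_field.
From mathcomp Require Import boolp.
From mathcomp Require Import freeg.

Set Implicit Arguments.
Unset Strict Implicit.
Unset Printing Implicit Defensive.

Import GRing.Theory.
Local Open Scope ring_scope.
Local Open Scope quotient_scope.

(* -------------------------------------------------------------------------- *)
(* Finite G-sets. As everywhere in the library, groups act on the right.      *)

Record gset (gT : finGroupType) := GSet {
  gcar :> finType;
  gact : {action gT &-> gcar}
}.
Arguments GSet {gT} gcar gact.
Arguments gact {gT} g.

Record gmap (gT : finGroupType) (X Y : gset gT) := GMap {
  gfun :> X -> Y;
  gfunJ : forall x g, gfun (gact X x g) = gact Y (gfun x) g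
}.

Section GSets.
Variable gT : finGroupType.
Implicit Types X Y Z : gset gT.

Definition gid X : gmap X X := @GMap gT X X id (fun _ _ => erefl).

Lemma gcomp_subproof X Y Z (g : gmap Y Z) (f : gmap X Y) x a :
  (g \o f) (gact X x a) = gact Z ((g \o f) x) a.
Proof. by rewrite /= !gfunJ. Qed.
Definition gcomp X Y Z (g : gmap Y Z) (f : gmap X Y) : gmap X Z :=
  GMap (gcomp_subproof g f).

Lemma gmapP X Y (f g : gmap X Y) : f =1 g -> f = g.
Proof.
case: f g => [f fJ] [g gJ] /= /funext fg; rewrite fg in fJ *.
by congr GMap; apply: Prop_irrelevance.
Qed.

Definition void_act (x : void) (_ : gT) : void := x.
Lemma void_act1 : void_act^~ 1%g =1 id. Proof. by []. Qed.
Lemma void_actM x : act_morph void_act x. Proof. by []. Qed.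
Definition gempty : gset gT := GSet void (TotalAction void_act1 void_actM).

Section Sum.
Variables X Y : gset gT.
Definition sum_act (z : X + Y) (a : gT) : X + Y :=
  match z with inl x => inl (gact X x a) | inr y => inr (gact Y y a) end.
Lemma sum_act1 : sum_act^~ 1%g =1 id.
Proof. by case=> z /=; rewrite act1. Qed.
Lemma sum_actM z : act_morph sum_act z.
Proof. by case: z => z a b /=; rewrite actM. Qed.
Definition gsum : gset gT := GSet (X + Y)%type (TotalAction sum_act1 sum_actM).
Definition ginl : gmap X gsum := @GMap gT X gsum inl (fun _ _ => erefl).
Definition ginr : gmap Y gsum := @GMap gT Y gsum inr (fun _ _ => erefl).
End Sum.

(*       P --q--> Y                                                           *)
(*      p|        |g       is a pullback square of G-sets.                    *)
(*       X --f--> Z                                                           *)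
Definition pullback (P X Y Z : gset gT)
    (p : gmap P X) (q : gmap P Y) (f : gmap X Z) (g : gmap Y Z) : Prop :=
  (forall w, f (p w) = g (q w)) /\
  (forall x y, f x = g y -> exists! w, p w = x /\ q w = y).

(*     X <--e-- A --p--> D                                                    *)
(*     |f       |        |h                                                   *)
(*     Y ====== Y --g--> Z                                                    *)
(* is an exponential diagram: the right-hand rectangle (with A -> Y the map   *)
(* f \o e) is a pullback, and h : D -> Z is the dependent product of f along  *)
(* g, i.e. the fibre of D over z is the set of sections of f over g^-1(z),    *)
(* with evaluation map e.                                                     *)
Definition exponential (X Y Z A D : gset gT)
    (f : gmap X Y) (g : gmap Y Z)
    (e : gmap A X) (p : gmap A D) (h : gmap D Z) : Prop :=
  pullback (gcomp f e) p g h /\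
  (forall (z : Z) (s : {y : Y | g y == z} -> X),
     (forall y, f (s y) = val y) ->
     exists! d, h d = z /\
       forall (a : A) y, p a = d -> f (e a) = val y -> e a = s y).

Definition two_surjective X Y (f : gmap X Y) : Prop :=
  forall y : Y, (1 < #|[set x | f x == y]|)%N.

End GSets.

(* -------------------------------------------------------------------------- *)
(* Mackey functors, commutative Green functors, Tambara functors              *)

Record mackey_axioms (gT : finGroupType) (M : gset gT -> zmodType)
    (res : forall X Y, gmap X Y -> M Y -> M X)
    (tr : forall X Y, gmap X Y -> M X -> M Y) : Prop := MackeyAxioms {
  ax_res_id : forall X (m : M X), res X X (gid X) m = m;
  ax_res_comp : forall X Y Z (g : gmap Y Z) (f : gmap X Y) (m : M Z),
    res X Z (gcomp g f) m = res X Y f (res Y Z g m);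
  ax_tr_id : forall X (m : M X), tr X X (gid X) m = m;
  ax_tr_comp : forall X Y Z (g : gmap Y Z) (f : gmap X Y) (m : M X),
    tr X Z (gcomp g f) m = tr Y Z g (tr X Y f m);
  ax_base_change : forall P X Y Z (p : gmap P X) (q : gmap P Y)
      (f : gmap X Z) (g : gmap Y Z), pullback p q f g ->
    forall m : M X, res Y Z g (tr X Z f m) = tr P Y q (res P X p m);
  ax_empty : forall m : M (gempty gT), m = 0;
  ax_sum : forall X Y, bijective (fun m : M (gsum X Y) =>
    (res X (gsum X Y) (ginl X Y) m, res Y (gsum X Y) (ginr X Y) m))
}.

Record mackey (gT : finGroupType) := Mackey {
  mobj :> gset gT -> zmodType;
  mres : forall X Y, gmap X Y -> {additive mobj Y -> mobj X};
  mtr : forall X Y, gmap X Y -> {additive mobj X -> mobj Y};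
  mackeyP : mackey_axioms (fun X Y f => mres f : mobj Y -> mobj X)
                          (fun X Y f => mtr f : mobj X -> mobj Y)
}.
Arguments mres {gT} m {X Y}.
Arguments mtr {gT} m {X Y}.

(* A commutative Green functor, i.e. a commutative monoid for the box         *)
(* product, in its unfolded (Dress pairing) form.                             *)
Record green (gT : finGroupType) := Green {
  gobj :> gset gT -> comPzRingType;
  gres : forall X Y, gmap X Y -> {rmorphism gobj Y -> gobj X};
  gtr : forall X Y, gmap X Y -> {additive gobj X -> gobj Y};
  gmackeyP : mackey_axioms (fun X Y f => gres f : gobj Y -> gobj X)
                           (fun X Y f => gtr f : gobj X -> gobj Y);
  gfrob : forall X Y (f : gmap X Y) (r : gobj Y) (s : gobj X),
    gtr f (gres f r * s) = r * gtr f s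
}.
Arguments gres {gT} g {X Y}.
Arguments gtr {gT} g {X Y}.

Definition green_mackey (gT : finGroupType) (R : green gT) : mackey gT :=
  @Mackey gT (fun X => R X) (fun X Y f => gres R f) (fun X Y f => gtr R f)
    (gmackeyP R).

Record tambara_axioms (gT : finGroupType) (R : green gT)
    (nm : forall X Y, gmap X Y -> R X -> R Y) : Prop := TambaraAxioms {
  ax_norm1 : forall X Y (f : gmap X Y), nm X Y f 1 = 1;
  ax_normM : forall X Y (f : gmap X Y) (a b : R X),
    nm X Y f (a * b) = nm X Y f a * nm X Y f b;
  ax_norm_id : forall X (a : R X), nm X X (gid X) a = a;
  ax_norm_comp : forall X Y Z (g : gmap Y Z) (f : gmap X Y) (a : R X),
    nm X Z (gcomp g f) a = nm Y Z g (nm X Y f a);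
  ax_norm_base_change : forall P X Y Z (p : gmap P X) (q : gmap P Y)
      (f : gmap X Z) (g : gmap Y Z), pullback p q f g ->
    forall a : R X, gres R g (nm X Z f a) = nm P Y q (gres R p a);
  ax_distributive : forall X Y Z A D (f : gmap X Y) (g : gmap Y Z)
      (e : gmap A X) (p : gmap A D) (h : gmap D Z), exponential f g e p h ->
    forall a : R X, nm Y Z g (gtr R f a) = gtr R h (nm A D p (gres R e a))
}.

Record tambara (gT : finGroupType) := Tambara {
  tgreen :> green gT;
  tnorm : forall X Y, gmap X Y -> tgreen X -> tgreen Y;
  tambaraP : tambara_axioms tnorm
}.
Arguments tnorm {gT} t {X Y}.

Record tambara_map (gT : finGroupType) (R T : tambara gT) := TambaraMap {
  tmap :> forall X, {rmorphism R X -> T X};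
  tmap_res : forall X Y (f : gmap X Y) (a : R Y),
    tmap X (gres R f a) = gres T f (tmap Y a);
  tmap_tr : forall X Y (f : gmap X Y) (a : R X),
    tmap Y (gtr R f a) = gtr T f (tmap X a);
  tmap_norm : forall X Y (f : gmap X Y) (a : R X),
    tmap Y (tnorm R f a) = tnorm T f (tmap X a)
}.

Definition tambara_id (gT : finGroupType) (T : tambara gT) : tambara_map T T :=
  @TambaraMap gT T T (fun X => idfun : {rmorphism T X -> T X})
    (fun _ _ _ _ => erefl) (fun _ _ _ _ => erefl) (fun _ _ _ _ => erefl).

(* -------------------------------------------------------------------------- *)
(* Modules over a Green functor                                               *)

(* An action of the monoid R on M amounts to R(X)-module structures on the    *)
(* M(X), compatible with restrictions and satisfying both Frobenius           *)
(* identities.                                                                *)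
Record gmodule (gT : finGroupType) (R : green gT) := GModule {
  gmk :> mackey gT;
  gscale : forall X, R X -> gmk X -> gmk X;
  gscaleA : forall X (r s : R X) (m : gmk X),
    gscale r (gscale s m) = gscale (r * s) m;
  gscale1 : forall X (m : gmk X), gscale 1 m = m;
  gscaleDl : forall X (r s : R X) (m : gmk X),
    gscale (r + s) m = gscale r m + gscale s m;
  gscaleDr : forall X (r : R X) (m n : gmk X),
    gscale r (m + n) = gscale r m + gscale r n;
  gscale_res : forall X Y (f : gmap X Y) (r : R Y) (m : gmk Y),
    mres gmk f (gscale r m) = gscale (gres R f r) (mres gmk f m);
  gscale_tr : forall X Y (f : gmap X Y) (r : R Y) (m : gmk X),
    mtr gmk f (gscale (gres R f r) m) = gscale r (mtr gmk f m);
  gtr_scale : forall X Y (f : gmap X Y) (r : R X) (m : gmk Y),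
    mtr gmk f (gscale r (mres gmk f m)) = gscale (gtr R f r) m
}.
Arguments gscale {gT R} g {X}.

Record gmodule_map (gT : finGroupType) (R : green gT) (M N : gmodule R) :=
  GModuleMap {
  mmap :> forall X, {additive M X -> N X};
  mmap_res : forall X Y (f : gmap X Y) (m : M Y),
    mmap X (mres M f m) = mres N f (mmap Y m);
  mmap_tr : forall X Y (f : gmap X Y) (m : M X),
    mmap Y (mtr M f m) = mtr N f (mmap X m);
  mmap_scale : forall X (r : R X) (m : M X),
    mmap X (gscale M r m) = gscale N r (mmap X m)
}.

Section RestrictScalars.
Variables (gT : finGroupType) (R T : tambara gT) (phi : tambara_map R T).

Definition tscale X (r : R X) (t : green_mackey T X) : green_mackey T X :=
  phi X r * (t : T X).

Lemma tscaleA X (r s : R X) t : tscale r (tscale s t) = tscale (r * s) t.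
Proof. by rewrite /tscale rmorphM mulrA. Qed.
Lemma tscale1 X t : tscale (1 : R X) t = t.
Proof. by rewrite /tscale rmorph1 mul1r. Qed.
Lemma tscaleDl X (r s : R X) t : tscale (r + s) t = tscale r t + tscale s t.
Proof. by rewrite /tscale rmorphD mulrDl. Qed.
Lemma tscaleDr X (r : R X) t u : tscale r (t + u) = tscale r t + tscale r u.
Proof. by rewrite /tscale mulrDr. Qed.
Lemma tscale_res X Y (f : gmap X Y) (r : R Y) t :
  mres (green_mackey T) f (tscale r t) =
  tscale (gres R f r) (mres (green_mackey T) f t).
Proof. by rewrite /tscale /= tmap_res -rmorphM. Qed.
Lemma tscale_tr X Y (f : gmap X Y) (r : R Y) t :
  mtr (green_mackey T) f (tscale (gres R f r) t) =
  tscale r (mtr (green_mackey T) f t).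
Proof. by rewrite /tscale /= tmap_res gfrob. Qed.
Lemma tr_tscale X Y (f : gmap X Y) (r : R X) t :
  mtr (green_mackey T) f (tscale r (mres (green_mackey T) f t)) =
  tscale (gtr R f r) t.
Proof. by rewrite /tscale /= mulrC gfrob tmap_tr mulrC. Qed.

Definition restrict_scalars : gmodule R :=
  GModule tscaleA tscale1 tscaleDl tscaleDr tscale_res tscale_tr tr_tscale.

End RestrictScalars.

(* -------------------------------------------------------------------------- *)
(* Subgroups and quotient groups                                              *)

Section Span.
Variables (V : zmodType) (G : V -> Prop).

Definition subgroup_pred (S : V -> Prop) : Prop :=
  S 0 /\ (forall x y, S x -> S y -> S (x - y)).

Definition span : {pred V} := fun x =>
  `[< forall S : V -> Prop, subgroup_pred S -> (forall y, G y -> S y) -> S x >].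

Lemma spanP x : reflect
  (forall S : V -> Prop, subgroup_pred S -> (forall y, G y -> S y) -> S x)
  (x \in span).
Proof. exact: asboolP. Qed.

Lemma mem_span x : G x -> x \in span.
Proof. by move=> Gx; apply/spanP => S _; apply. Qed.

Lemma span_zmod_closed : zmod_closed span.
Proof.
split=> [|x y /spanP Sx /spanP Sy]; apply/spanP => S SP GS.
  exact: SP.1.
exact: SP.2 (Sx S SP GS) (Sy S SP GS).
Qed.
HB.instance Definition _ := GRing.isZmodClosed.Build V span span_zmod_closed.

Lemma span_lift (W : zmodType) (h : {additive V -> W}) :
  (forall x, G x -> h x = 0) -> forall x, x \in span -> h x = 0.
Proof.
move=> hG x /spanP/(_ (fun y => h y = 0)); apply=> //.
by split=> [|y z hy hz]; rewrite ?raddf0 // raddfB hy hz subr0.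
Qed.

End Span.

Notation quot I := (Quotient.quot I).

Section QuotLift.
Variables (V W : zmodType) (I : zmodClosed V) (h : {additive V -> W}).

Definition quot_lift (_ : forall x, x \in I -> h x = 0) (q : quot I) : W :=
  h (generic_quotient.repr q).
Hypothesis hI : forall x, x \in I -> h x = 0.

Lemma quot_liftE x : quot_lift hI (\pi_(quot I) x) = h x.
Proof.
apply/eqP; rewrite -subr_eq0 -raddfB; apply/eqP/hI.
by rewrite Quotient.idealrBE reprK.
Qed.

Lemma quot_lift_additive : zmod_morphism (quot_lift hI).
Proof.
move=> x y; rewrite -[x]reprK -[y]reprK -raddfB.
by rewrite !quot_liftE raddfB.
Qed.
HB.instance Definition _ :=
  GRing.isZmodMorphism.Build (quot I) W (quot_lift hI) quot_lift_additive.
End QuotLift.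

(* -------------------------------------------------------------------------- *)
(* Box products                                                               *)

(* The finite G-sets carried by some 'I_n; every finite G-set is isomorphic   *)
(* to one of these. The coend defining the box product is indexed by them, in *)
(* order to be a small one.                                                   *)
Record ogset (gT : finGroupType) := OGSet {
  osize : nat;
  oact : {action gT &-> 'I_osize}
}.
Coercion gset_of_ogset (gT : finGroupType) (U : ogset gT) : gset gT :=
  GSet 'I_(osize U) (oact U).

(* Writing M [] N for the box product,                                        *)
(* (M [] N)(X) is the quotient of the direct sum, over all f : U -> X, of the *)
(* groups M(U) (x)_Z N(U) by the subgroup generated by                        *)
(*    tr_k(m) (x) n - m (x) res_k(n)  and  m (x) tr_k(n) - res_k(m) (x) n     *)
(* for all k : U -> U' over X. It is presented below by the generators        *)
(* [U, f, m (x) n].                                                           *)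
Section Box.
Variables (gT : finGroupType) (M N : mackey gT) (X : gset gT).

Record box_gen := BoxGen {
  bset : ogset gT;
  bmap : gmap bset X;
  bleft : M bset;
  bright : N bset
}.

Definition box_free : zmodType := {freeg {classic box_gen} / int}.

Definition bsym (U : ogset gT) (f : gmap U X) (m : M U) (n : N U) : box_free :=
  << (BoxGen f m n : {classic box_gen}) >>.

Inductive box_rel : box_free -> Prop :=
| BoxDl (U : ogset gT) (f : gmap U X) m1 m2 n :
    box_rel (bsym f (m1 + m2) n - (bsym f m1 n + bsym f m2 n))
| BoxDr (U : ogset gT) (f : gmap U X) m n1 n2 :
    box_rel (bsym f m (n1 + n2) - (bsym f m n1 + bsym f m n2))
| BoxFrobl (U U' : ogset gT) (k : gmap U U') (f : gmap U' X) m n :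
    box_rel (bsym f (mtr M k m) n - bsym (gcomp f k) m (mres N k n))
| BoxFrobr (U U' : ogset gT) (k : gmap U U') (f : gmap U' X) m n :
    box_rel (bsym f m (mtr N k n) - bsym (gcomp f k) (mres M k m) n).

Definition box : zmodType := quot (span box_rel).

Definition box_class (U : ogset gT) (f : gmap U X) (m : M U) (n : N U) : box :=
  \pi_(quot (span box_rel)) (bsym f m n).

Section Lift.
Variables (W : zmodType).
Variable h : forall U : ogset gT, gmap U X -> M U -> N U -> W.
Arguments h {U}.

Record box_compatible : Prop := BoxCompatible {
  box_hDl : forall (U : ogset gT) (f : gmap U X) m1 m2 n,
    h f (m1 + m2) n = h f m1 n + h f m2 n;
  box_hDr : forall (U : ogset gT) (f : gmap U X) m n1 n2,
    h f m (n1 + n2) = h f m n1 + h f m n2;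
  box_hFl : forall (U U' : ogset gT) (k : gmap U U') (f : gmap U' X) m n,
    h f (mtr M k m) n = h (gcomp f k) m (mres N k n);
  box_hFr : forall (U U' : ogset gT) (k : gmap U U') (f : gmap U' X) m n,
    h f m (mtr N k n) = h (gcomp f k) (mres M k m) n
}.
Hypothesis hP : box_compatible.

Definition box_free_lift (x : box_free) : W :=
  fglift (fun g : {classic box_gen} =>
    h (bmap g) (bleft g) (bright g) : zmodule W) x.

Lemma box_free_lift_additive : zmod_morphism box_free_lift.
Proof. by move=> x y; rewrite /box_free_lift lift_is_additive. Qed.
HB.instance Definition _ := GRing.isZmodMorphism.Build box_free W
  box_free_lift box_free_lift_additive.

Lemma box_free_liftE (U : ogset gT) (f : gmap U X) m n :
  box_free_lift (bsym f m n) = h f m n.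
Proof. by rewrite /box_free_lift /bsym liftU scale1r. Qed.

Lemma box_free_lift_rel x : x \in span box_rel -> box_free_lift x = 0.
Proof.
apply: span_lift => {}x; case=> *; apply/eqP;
  rewrite raddfB subr_eq0 ?raddfD /= !box_free_liftE;
by rewrite (box_hDl hP, box_hDr hP, box_hFl hP, box_hFr hP).
Qed.

Definition box_lift : {additive box -> W} := quot_lift box_free_lift_rel.

Lemma box_liftE (U : ogset gT) (f : gmap U X) m n : box_lift (box_class f m n) = h f m n.
Proof. exact: etrans (quot_liftE _ _) (box_free_liftE _ _ _). Qed.
End Lift.

End Box.

(* The coequalizer of M [] R [] N => M [] N, computed levelwise: the group    *)
(* (M [] R [] N)(X) is generated by the [U, f, m (x) r (x) n].                *)
Section RelativeBox.
Variables (gT : finGroupType) (R : green gT) (M N : gmodule R) (X : gset gT).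

Inductive coeq_rel : box M N X -> Prop :=
| CoeqRel (U : ogset gT) (f : gmap U X) (m : M U) (r : R U) (n : N U) :
    coeq_rel (box_class f (gscale M r m) n - box_class f m (gscale N r n)).

Definition relbox : zmodType := quot (span coeq_rel).

Definition relbox_class (U : ogset gT) (f : gmap U X) (m : M U) (n : N U) :
  relbox := \pi_(quot (span coeq_rel)) (box_class f m n).

Section Lift.
Variables (W : zmodType).
Variable h : forall U : ogset gT, gmap U X -> M U -> N U -> W.
Arguments h {U}.
Hypothesis hP : box_compatible (@h).
Hypothesis hbal : forall (U : ogset gT) (f : gmap U X) m (r : R U) n,
  h f (gscale M r m) n = h f m (gscale N r n).

Lemma box_lift_coeq x : x \in span coeq_rel -> box_lift hP x = 0.
Proof.
apply: span_lift => _ [U f m r n].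
by rewrite raddfB !box_liftE hbal subrr.
Qed.

Definition relbox_lift : {additive relbox -> W} := quot_lift box_lift_coeq.

Lemma relbox_liftE (U : ogset gT) (f : gmap U X) m n :
  relbox_lift (relbox_class f m n) = h f m n.
Proof. exact: etrans (quot_liftE _ _) (box_liftE _ _ _ _). Qed.
End Lift.

Lemma relbox_classDl (U : ogset gT) (f : gmap U X) m1 m2 n :
  relbox_class f (m1 + m2) n = relbox_class f m1 n + relbox_class f m2 n.
Proof.
rewrite /relbox_class /box_class -!raddfD /=; congr (\pi_ _ _).
apply/eqP; rewrite -Quotient.idealrBE; exact/mem_span/BoxDl.
Qed.

Lemma relbox_classDr (U : ogset gT) (f : gmap U X) m n1 n2 :
  relbox_class f m (n1 + n2) = relbox_class f m n1 + relbox_class f m n2.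
Proof.
rewrite /relbox_class /box_class -!raddfD /=; congr (\pi_ _ _).
apply/eqP; rewrite -Quotient.idealrBE; exact/mem_span/BoxDr.
Qed.

Lemma relbox_classFl (U U' : ogset gT) (k : gmap U U') (f : gmap U' X) m n :
  relbox_class f (mtr M k m) n = relbox_class (gcomp f k) m (mres N k n).
Proof.
congr (\pi_ _ _); apply/eqP; rewrite -Quotient.idealrBE.
exact/mem_span/BoxFrobl.
Qed.

Lemma relbox_classFr (U U' : ogset gT) (k : gmap U U') (f : gmap U' X) m n :
  relbox_class f m (mtr N k n) = relbox_class (gcomp f k) (mres M k m) n.
Proof.
congr (\pi_ _ _); apply/eqP; rewrite -Quotient.idealrBE.
exact/mem_span/BoxFrobr.
Qed.

Lemma relbox_class_bal (U : ogset gT) (f : gmap U X) m (r : R U) n :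
  relbox_class f (gscale M r m) n = relbox_class f m (gscale N r n).
Proof. by apply/eqP; rewrite -Quotient.idealrBE; apply/mem_span/CoeqRel. Qed.

End RelativeBox.

Section RelativeBoxMap.
Variables (gT : finGroupType) (R : green gT) (T M N : gmodule R).
Variables (u : gmodule_map M N) (X : gset gT).

Lemma relbox_map_compatible : box_compatible
  (fun (U : ogset gT) (f : gmap U X) (t : T U) (m : M U) => relbox_class f t (u U m)).
Proof.
split=> *; rewrite ?raddfD ?mmap_res ?mmap_tr.
- exact: relbox_classDl.
- exact: relbox_classDr.
- exact: relbox_classFl.
- exact: relbox_classFr.
Qed.

Lemma relbox_map_bal (U : ogset gT) (f : gmap U X) t (r : R U) m :
  relbox_class f (gscale T r t) (u U m) = relbox_class f t (u U (gscale M r m)).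
Proof. by rewrite mmap_scale relbox_class_bal. Qed.

Definition relbox_map : {additive relbox T M X -> relbox T N X} :=
  relbox_lift relbox_map_compatible relbox_map_bal.

End RelativeBoxMap.

Definition short_exact (A B C : zmodType) (f : A -> B) (g : B -> C) : Prop :=
  [/\ injective f, forall b, g b = 0 <-> (exists a, f a = b)
    & forall c, exists b, g b = c].

Definition flat (gT : finGroupType) (R : green gT) (T : gmodule R) : Prop :=
  forall (M' M M'' : gmodule R) (i : gmodule_map M' M) (p : gmodule_map M M''),
    (forall X, short_exact (i X) (p X)) ->
    forall X, short_exact (relbox_map T i X) (relbox_map T p X).

(* -------------------------------------------------------------------------- *)
(* Tambara Kaehler differentials                                              *)

Section Pairing.
Variables (gT : finGroupType) (R T P : tambara gT) (phi : tambara_map R T).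
Variables (i1 i2 : tambara_map T P).
Hypothesis i12 : forall X (r : R X), i1 X (phi X r) = i2 X (phi X r).
Local Notation TR := (restrict_scalars phi).
Variable X : gset gT.

Definition pairing (U : ogset gT) (f : gmap U X) (a b : T U) : P X :=
  gtr P f (i1 U a * i2 U b).

Lemma pairing_compatible :
  box_compatible (M := TR) (N := TR) pairing.
Proof.
rewrite /pairing; split=> /= [U f a a' b|U f a b b'|U V k f a b|U V k f a b].
- by rewrite rmorphD mulrDl raddfD.
- by rewrite rmorphD mulrDr raddfD.
- rewrite (ax_tr_comp (gmackeyP P)) tmap_res tmap_tr mulrC -gfrob.
  by rewrite [_ * i1 _ _]mulrC.
- by rewrite (ax_tr_comp (gmackeyP P)) tmap_res tmap_tr -gfrob.
Qed.

Lemma pairing_bal (U : ogset gT) (f : gmap U X) (a : TR U) (r : R U) (b : TR U) :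
  pairing f (gscale TR r a) b = pairing f a (gscale TR r b).
Proof.
by rewrite /pairing /= /tscale !rmorphM i12 mulrA [_ * i1 _ _]mulrC.
Qed.

(* [U, f, a (x) b] |-> tr_f(i1(a) i2(b))                                      *)
Definition box_pairing : {additive relbox TR TR X -> P X} :=
  relbox_lift pairing_compatible pairing_bal.

End Pairing.

Definition box_mult (gT : finGroupType) (R T : tambara gT)
    (phi : tambara_map R T) (X : gset gT) :
    {additive relbox (restrict_scalars phi) (restrict_scalars phi) X -> T X} :=
  box_pairing (phi := phi) (i1 := tambara_id T) (i2 := tambara_id T)
    (fun _ _ => erefl) X.

(* The Tambara functor T []_R T: a Tambara functor whose underlying Green     *)
(* functor is T []_R T, and whose norms are those for which the two maps      *)
(* T -> T []_R T are maps of Tambara functors. This determines the norms, as  *)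
(* every element of (T []_R T)(X) is of the form tr_f(i1(a) i2(b)), whose     *)
(* norms are given by the distributive law.                                   *)
Record tambara_box (gT : finGroupType) (R T : tambara gT)
    (phi : tambara_map R T) := TambaraBox {
  tbox :> tambara gT;
  tbox_inl : tambara_map T tbox;
  tbox_inr : tambara_map T tbox;
  tbox_compat : forall X (r : R X),
    tbox_inl X (phi X r) = tbox_inr X (phi X r);
  tbox_iso : forall X, bijective (box_pairing tbox_compat X)
}.

Section Kaehler.
Variables (gT : finGroupType) (R T : tambara gT) (phi : tambara_map R T).
Variable B : tambara_box phi.

Definition aug_ideal X : {pred B X} := fun p =>
  `[< exists2 z, box_mult phi X z = 0
        & box_pairing (@tbox_compat _ _ _ _ B) X z = p >].

Lemma aug_ideal_zmod_closed X : zmod_closed (@aug_ideal X).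
Proof.
split=> [|p q /asboolP[y y0 <-] /asboolP[z z0 <-]]; apply/asboolP.
  by exists 0; rewrite raddf0.
by exists (y - z); rewrite raddfB ?y0 ?z0 ?subr0.
Qed.
HB.instance Definition _ X :=
  GRing.isZmodClosed.Build (B X) (@aug_ideal X) (@aug_ideal_zmod_closed X).

(* Ideals of the underlying Green functor                                     *)
Record green_ideal (J : forall X, B X -> Prop) : Prop := GreenIdeal {
  idealB : forall X a b, J X a -> J X b -> J X (a - b);
  ideal0 : forall X, J X 0;
  idealM : forall X r a, J X a -> J X (r * a);
  ideal_res : forall X Y (f : gmap X Y) a, J Y a -> J X (gres B f a);
  ideal_tr : forall X Y (f : gmap X Y) a, J X a -> J Y (gtr B f a)
}.

Definition norm_ideal Y : {pred B Y} := fun b =>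
  `[< forall J, green_ideal J ->
        (forall X Z (f : gmap X Z) (x : B X), two_surjective f ->
           x \in @aug_ideal X -> J Z (tnorm B f x)) ->
        J Y b >].

Definition aug_type X := {p : B X | p \in @aug_ideal X}.
HB.instance Definition _ X := SubChoice.on (aug_type X).
HB.instance Definition _ X := [SubChoice_isSubZmodule of aug_type X by <:].

Definition norm_ideal_in X : {pred aug_type X} :=
  fun p => val p \in @norm_ideal X.

Lemma norm_ideal_in_zmod_closed X : zmod_closed (@norm_ideal_in X).
Proof.
split=> [|p q /asboolP Jp /asboolP Jq]; apply/asboolP=> J idJ nJ.
  exact: (ideal0 idJ).
exact: (idealB idJ) (Jp J idJ nJ) (Jq J idJ nJ).
Qed.
HB.instance Definition _ X :=
  GRing.isZmodClosed.Build (aug_type X) (@norm_ideal_in X)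
    (@norm_ideal_in_zmod_closed X).

Definition kaehler X : zmodType := quot (@norm_ideal_in X).

End Kaehler.

Definition tambara_etale (gT : finGroupType) (R T : tambara gT)
    (phi : tambara_map R T) : Prop :=
  flat (restrict_scalars phi) /\
  (inhabited (tambara_box phi) /\
   forall (B : tambara_box phi) X (w : kaehler B X), w = 0).

(* -------------------------------------------------------------------------- *)
(* Fixed point functors                                                       *)

Record gring (gT : finGroupType) := GRingAct {
  gring_ring :> comPzRingType;
  gring_act : gT -> {rmorphism gring_ring -> gring_ring};
  gring_act1 : forall a, gring_act 1%g a = a;
  gring_actM : forall g h a, gring_act (g * h)%g a = gring_act h (gring_act g a)
}.
Arguments gring_act {gT} _ _.

(* T^fix(X) is the ring of G-maps X -> T; for X = G/H, evaluation at the coset *)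
(* of 1 identifies it with T^H. Along f : X -> Y the transfer sums, and the   *)
(* norm multiplies, the values over the fibres of f.                          *)
Section FixedPoints.
Variables (gT : finGroupType) (T : gring gT).
Implicit Types X Y Z : gset gT.

Definition equivariant X : {pred {ffun X -> T}} := fun u =>
  [forall g, forall x, u (gact X x g) == gring_act T g (u x)].

Lemma equivariantP X (u : {ffun X -> T}) :
  reflect (forall x g, u (gact X x g) = gring_act T g (u x))
          (u \in @equivariant X).
Proof.
apply: (iffP forallP) => [uJ x g|uJ g]; last by apply/forallP => x; apply/eqP.
by apply/eqP; move: (uJ g) => /forallP; apply.
Qed.

Lemma equivariant_subring_closed X : subring_closed (@equivariant X).
Proof.
split=> [|u v /equivariantP uJ /equivariantP vJ|
          u v /equivariantP uJ /equivariantP vJ];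
  apply/equivariantP => x g; rewrite !ffunE.
- by rewrite rmorph1.
- by rewrite uJ vJ rmorphB.
- by rewrite uJ vJ rmorphM.
Qed.
HB.instance Definition _ X := GRing.isSubringClosed.Build {ffun X -> T}
  (@equivariant X) (@equivariant_subring_closed X).

Definition fix_obj X := {u : {ffun X -> T} | u \in @equivariant X}.
HB.instance Definition _ X := SubChoice.on (fix_obj X).
HB.instance Definition _ X := GRing.SubChoice_isSubPzRing.Build {ffun X -> T}
  (@equivariant X) (fix_obj X) (@equivariant_subring_closed X).

Lemma fix_mulC X : commutative (@GRing.mul (fix_obj X)).
Proof.
by move=> u v; apply/val_inj/ffunP => x; rewrite /= !ffunE mulrC.
Qed.
HB.instance Definition _ X :=
  GRing.PzRing_hasCommutativeMul.Build (fix_obj X) (@fix_mulC X).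

Definition fix_val X (u : fix_obj X) (x : X) : T := (val u : {ffun X -> T}) x.

Lemma fix_valJ X (u : fix_obj X) x g :
  fix_val u (gact X x g) = gring_act T g (fix_val u x).
Proof. by case: u => u uJ; apply/equivariantP. Qed.

Lemma fix_ext X (u v : fix_obj X) : fix_val u =1 fix_val v -> u = v.
Proof. by move=> uv; apply/val_inj/ffunP. Qed.

Lemma fix_valD X (u v : fix_obj X) x :
  fix_val (u + v) x = fix_val u x + fix_val v x.
Proof. by rewrite /fix_val /= ffunE. Qed.
Lemma fix_valB X (u v : fix_obj X) x :
  fix_val (u - v) x = fix_val u x - fix_val v x.
Proof. by rewrite /fix_val /= !ffunE. Qed.
Lemma fix_val1 X x : fix_val (1 : fix_obj X) x = 1.
Proof. by rewrite /fix_val /= ffunE. Qed.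
Lemma fix_valM X (u v : fix_obj X) x :
  fix_val (u * v) x = fix_val u x * fix_val v x.
Proof. by rewrite /fix_val /= ffunE. Qed.

Section Operations.
Variables (X Y : gset gT) (f : gmap X Y).

Lemma fix_res_subproof (u : fix_obj Y) :
  [ffun x => fix_val u (f x)] \in @equivariant X.
Proof. by apply/equivariantP => x g; rewrite !ffunE gfunJ fix_valJ. Qed.
Definition fix_res (u : fix_obj Y) : fix_obj X :=
  exist _ [ffun x => fix_val u (f x)] (fix_res_subproof u).

Lemma fiber_actE g y x :
  (f (gact X x g) == gact Y y g) = (f x == y).
Proof. by rewrite gfunJ (inj_eq (act_inj _ _)). Qed.

Lemma fix_tr_subproof (u : fix_obj X) :
  [ffun y => \sum_(x | f x == y) fix_val u x] \in @equivariant Y.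
Proof.
apply/equivariantP => y g; rewrite !ffunE rmorph_sum /=.
rewrite (reindex_inj (act_inj (gact X) g)) /=.
by apply: eq_big => x; rewrite ?fiber_actE ?fix_valJ.
Qed.
Definition fix_tr (u : fix_obj X) : fix_obj Y :=
  exist _ [ffun y => \sum_(x | f x == y) fix_val u x] (fix_tr_subproof u).

Lemma fix_norm_subproof (u : fix_obj X) :
  [ffun y => \prod_(x | f x == y) fix_val u x] \in @equivariant Y.
Proof.
apply/equivariantP => y g; rewrite !ffunE rmorph_prod /=.
rewrite (reindex_inj (act_inj (gact X) g)) /=.
by apply: eq_big => x; rewrite ?fiber_actE ?fix_valJ.
Qed.
Definition fix_norm (u : fix_obj X) : fix_obj Y :=
  exist _ [ffun y => \prod_(x | f x == y) fix_val u x] (fix_norm_subproof u).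

Lemma fix_resE u x : fix_val (fix_res u) x = fix_val u (f x).
Proof. by rewrite /fix_val /= ffunE. Qed.
Lemma fix_trE u y : fix_val (fix_tr u) y = \sum_(x | f x == y) fix_val u x.
Proof. by rewrite /fix_val /= ffunE. Qed.
Lemma fix_normE u y : fix_val (fix_norm u) y = \prod_(x | f x == y) fix_val u x.
Proof. by rewrite /fix_val /= ffunE. Qed.

Lemma fix_res_zmod : zmod_morphism fix_res.
Proof.
by move=> u v; apply: fix_ext => x; rewrite fix_valB !fix_resE fix_valB.
Qed.
Lemma fix_res_monoid : monoid_morphism fix_res.
Proof.
split=> [|u v]; apply: fix_ext => x; first by rewrite fix_resE !fix_val1.
by rewrite fix_valM !fix_resE fix_valM.
Qed.
HB.instance Definition _ :=
  GRing.isZmodMorphism.Build (fix_obj Y) (fix_obj X) fix_res fix_res_zmod.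
HB.instance Definition _ :=
  GRing.isMonoidMorphism.Build (fix_obj Y) (fix_obj X) fix_res fix_res_monoid.

Lemma fix_tr_zmod : zmod_morphism fix_tr.
Proof.
move=> u v; apply: fix_ext => y; rewrite fix_valB !fix_trE -sumrB.
by apply: eq_bigr => x _; rewrite fix_valB.
Qed.
HB.instance Definition _ :=
  GRing.isZmodMorphism.Build (fix_obj X) (fix_obj Y) fix_tr fix_tr_zmod.

End Operations.

Section BaseChange.
Variables (P X Y Z : gset gT).
Variables (p : gmap P X) (q : gmap P Y) (f : gmap X Z) (g : gmap Y Z).
Hypothesis pb : pullback p q f g.

Lemma pullback_big (R : Type) (idx : R) (op : Monoid.com_law idx) (F : X -> R) y :
  \big[op/idx]_(x | f x == g y) F x = \big[op/idx]_(w | q w == y) F (p w).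
Proof.
pose h x := [pick w | (p w == x) && (q w == y)].
rewrite (reindex_omap p h) => [|x /eqP e]; last first.
  have [w [[pw qw] _]] := pb.2 _ _ e.
  rewrite /h; case: pickP => /= [v /andP[/eqP-> _] //|/(_ w)].
  by rewrite pw qw !eqxx.
apply: eq_bigl => w; rewrite pb.1 /h; apply/andP/eqP => [[_]|qw].
  by case: pickP => // v /andP[_ /eqP qv] /eqP[<-].
split; first by rewrite qw.
case: pickP => [v /andP[/eqP pv /eqP qv]|/(_ w)]; last by rewrite qw !eqxx.
have e : f (p w) = g y by rewrite pb.1 qw.
have [w0 [_ uq]] := pb.2 _ _ e.
by rewrite -(uq v (conj pv qv)) (uq w (conj erefl qw)).
Qed.

End BaseChange.

Definition fix_glue_fun X Y (uv : fix_obj X * fix_obj Y) (z : gsum X Y) : T :=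
  match z with inl x => fix_val uv.1 x | inr y => fix_val uv.2 y end.
Lemma fix_glue_subproof X Y (uv : fix_obj X * fix_obj Y) :
  [ffun z => fix_glue_fun uv z] \in @equivariant (gsum X Y).
Proof. by apply/equivariantP => -[] z g; rewrite !ffunE /= fix_valJ. Qed.
Definition fix_glue X Y (uv : fix_obj X * fix_obj Y) : fix_obj (gsum X Y) :=
  exist _ [ffun z => fix_glue_fun uv z] (fix_glue_subproof uv).
Lemma fix_glueE X Y (uv : fix_obj X * fix_obj Y) z :
  fix_val (fix_glue uv) z = fix_glue_fun uv z.
Proof. by rewrite /fix_val /= ffunE. Qed.

Lemma fix_mackeyP : mackey_axioms (M := fix_obj) fix_res fix_tr.
Proof.
split.
- by move=> X u; apply: fix_ext => x; rewrite fix_resE.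
- by move=> X Y Z g f u; apply: fix_ext => x; rewrite !fix_resE.
- by move=> X u; apply: fix_ext => x; rewrite fix_trE big_pred1_eq.
- move=> X Y Z g f u; apply: fix_ext => z; rewrite !fix_trE.
  rewrite (partition_big f (fun y => g y == z)) //=.
  apply: eq_bigr => y /eqP gy; rewrite fix_trE; apply: eq_bigl => x.
  by case: (f x =P y) => [->|]; rewrite ?gy ?eqxx ?andbF.
- move=> P X Y Z p q f g pb u; apply: fix_ext => y.
  rewrite fix_resE !fix_trE (pullback_big pb).
  by apply: eq_bigr => w _; rewrite fix_resE.
- by move=> u; apply: fix_ext; case.
- move=> X Y.
  exists (@fix_glue X Y).
    by move=> u; apply: fix_ext => -[z|z]; rewrite fix_glueE /= fix_resE.
  by case=> u v; congr pair; apply: fix_ext => z; rewrite fix_resE fix_glueE.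
Qed.

Lemma fix_frob X Y (f : gmap X Y) (r : fix_obj Y) (s : fix_obj X) :
  fix_tr f (fix_res f r * s) = r * fix_tr f s.
Proof.
apply: fix_ext => y; rewrite fix_valM !fix_trE mulr_sumr.
by apply: eq_bigr => x /eqP <-; rewrite fix_valM fix_resE.
Qed.

Definition fix_green : green gT :=
  @Green gT fix_obj (fun X Y f => fix_res f) (fun X Y f => fix_tr f)
    fix_mackeyP fix_frob.

Section Distributive.
Variables (X Y Z A D : gset gT) (f : gmap X Y) (g : gmap Y Z).
Variables (e : gmap A X) (p : gmap A D) (h : gmap D Z).
Hypothesis ex : exponential f g e p h.

Lemma exponential_big (F : X -> T) z :
  \prod_(y | g y == z) \sum_(x | f x == y) F x =
  \sum_(d | h d == z) \prod_(a | p a == d) F (e a).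
Proof.
pose fib := {y : Y | g y == z}.
pose secs := family (fun y : fib => [pred x | f x == val y]).
pose sec := {s : {ffun fib -> X} | s \in secs}.
have secE (s : sec) y : f (val s y) = val y.
  by have /familyP/(_ y)/eqP := valP s.
have dP (s : sec) : exists! d, h d = z /\
    forall (a : A) y, p a = d -> f (e a) = val y -> e a = val s y.
  by apply: ex.2 => y; apply: secE.
pose to_d s := sval (cid (dP s)).
have to_dP s : h (to_d s) = z /\
    forall a y, p a = to_d s -> f (e a) = val y -> e a = val s y.
  by rewrite /to_d; case: cid => d [].
have to_d_uniq (s : sec) d : h d = z ->
    (forall a y, p a = d -> f (e a) = val y -> e a = val s y) -> to_d s = d.
  by rewrite /to_d; case: cid => d0 /= [_ uq] hd dE; exact: uq d (conj hd dE).
have to_d_inj : injective to_d.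
  move=> s t st; apply/val_inj/ffunP => y.
  have gy : g (val y) = h (to_d s) by rewrite (to_dP s).1 (eqP (valP y)).
  have [a [[fa pa] _]] := ex.1.2 _ _ gy.
  rewrite -((to_dP s).2 a y pa fa); apply: (to_dP t).2 => //.
  by rewrite -st.
have to_d_surj d : h d = z -> exists s, to_d s = d.
  move=> hd.
  have aP (y : fib) : exists a, f (e a) = val y /\ p a = d.
    have gy : g (val y) = h d by rewrite hd (eqP (valP y)).
    by have [a [aP _]] := ex.1.2 _ _ gy; exists a.
  have sP : [ffun y => e (sval (cid (aP y)))] \in secs.
    by apply/familyP => y; rewrite ffunE; case: cid => a /= [fa _]; rewrite inE fa.
  exists (exist (fun s => s \in secs) _ sP); apply: to_d_uniq => // a y pa fa /=.
  rewrite ffunE; case: cid => b /= [fb pb]; congr (e _).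
  have gy : g (val y) = h d by rewrite hd (eqP (valP y)).
  have [c [_ uq]] := ex.1.2 _ _ gy.
  by rewrite -(uq a (conj fa pa)) (uq b (conj fb pb)).
rewrite (big_sub (fun y => g y == z)) bigA_distr_big_dep (big_sub secs).
rewrite [RHS](reindex_omap to_d (fun d => [pick s | to_d s == d])); last first.
  move=> d /eqP/to_d_surj[s sd].
  by case: pickP => [t /eqP<- //|/(_ s)]; rewrite sd eqxx.
apply: eq_big => [s|s _].
  rewrite (to_dP s).1 eqxx; case: pickP => [t /eqP/to_d_inj->|/(_ s)];
  by rewrite eqxx.
pose G y := if insub y is Some y' then F (val s (y' : fib)) else 1.
transitivity (\prod_(y | g y == z) G y).
  rewrite (big_sub (fun y => g y == z)); apply: eq_bigr => y _.
  by rewrite /G valK.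
rewrite -[z in LHS](to_dP s).1 (pullback_big ex.1); apply: eq_bigr => a /eqP pa.
have fa : g (f (e a)) == z by rewrite ex.1.1 pa (to_dP s).1.
rewrite /G /= insubT; congr F; apply/esym.
exact: (to_dP s).2.
Qed.

End Distributive.

Lemma fix_tambaraP : tambara_axioms (R := fix_green) fix_norm.
Proof.
split.
- move=> X Y f; apply: fix_ext => y; rewrite fix_normE fix_val1 big1 //.
  by move=> x _; rewrite fix_val1.
- move=> X Y f u v; apply: fix_ext => y.
  rewrite fix_valM !fix_normE -big_split /=.
  by apply: eq_bigr => x _; rewrite fix_valM.
- by move=> X u; apply: fix_ext => x; rewrite fix_normE big_pred1_eq.
- move=> X Y Z g f u; apply: fix_ext => z; rewrite !fix_normE.
  rewrite (partition_big f (fun y => g y == z)) //=.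
  apply: eq_bigr => y /eqP gy; rewrite fix_normE; apply: eq_bigl => x.
  by case: (f x =P y) => [->|]; rewrite ?gy ?eqxx ?andbF.
- move=> P X Y Z p q f g pb u; apply: fix_ext => y.
  rewrite fix_resE !fix_normE (pullback_big pb).
  by apply: eq_bigr => w _; rewrite fix_resE.
- move=> X Y Z A D f g e p h ex u; apply: fix_ext => z.
  rewrite fix_normE fix_trE.
  under eq_bigr => y _ do rewrite fix_trE.
  rewrite (exponential_big ex); apply: eq_bigr => d _.
  by rewrite fix_normE; apply: eq_bigr => a _; rewrite fix_resE.
Qed.

Definition fix_tambara : tambara gT := Tambara fix_tambaraP.

End FixedPoints.

Section FixedPointsMap.
Variables (gT : finGroupType) (S T : gring gT) (j : {rmorphism S -> T}).
Hypothesis jJ : forall g a, j (gring_act S g a) = gring_act T g (j a).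

Lemma fix_map_subproof X (u : fix_obj S X) :
  [ffun x => j (fix_val u x)] \in @equivariant _ T X.
Proof. by apply/equivariantP => x g; rewrite !ffunE fix_valJ jJ. Qed.
Definition fix_map_fun X (u : fix_obj S X) : fix_obj T X :=
  exist _ [ffun x => j (fix_val u x)] (fix_map_subproof u).

Lemma fix_map_funE X (u : fix_obj S X) x :
  fix_val (fix_map_fun u) x = j (fix_val u x).
Proof. by rewrite /fix_val /= ffunE. Qed.

Lemma fix_map_zmod X : zmod_morphism (@fix_map_fun X).
Proof.
move=> u v; apply: fix_ext => x.
by rewrite fix_valB !fix_map_funE fix_valB rmorphB.
Qed.
Lemma fix_map_monoid X : monoid_morphism (@fix_map_fun X).
Proof.
split=> [|u v]; apply: fix_ext => x.
  by rewrite fix_map_funE !fix_val1 rmorph1.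
by rewrite fix_valM !fix_map_funE fix_valM rmorphM.
Qed.
HB.instance Definition _ X := GRing.isZmodMorphism.Build
  (fix_obj S X) (fix_obj T X) (@fix_map_fun X) (@fix_map_zmod X).
HB.instance Definition _ X := GRing.isMonoidMorphism.Build
  (fix_obj S X) (fix_obj T X) (@fix_map_fun X) (@fix_map_monoid X).

Lemma fix_map_res X Y (f : gmap X Y) (u : fix_obj S Y) :
  fix_map_fun (fix_res f u) = fix_res f (fix_map_fun u).
Proof. by apply: fix_ext => x; rewrite fix_map_funE !fix_resE fix_map_funE. Qed.
Lemma fix_map_tr X Y (f : gmap X Y) (u : fix_obj S X) :
  fix_map_fun (fix_tr f u) = fix_tr f (fix_map_fun u).
Proof.
apply: fix_ext => y; rewrite fix_map_funE !fix_trE rmorph_sum.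
by apply: eq_bigr => x _; rewrite fix_map_funE.
Qed.
Lemma fix_map_norm X Y (f : gmap X Y) (u : fix_obj S X) :
  fix_map_fun (fix_norm f u) = fix_norm f (fix_map_fun u).
Proof.
apply: fix_ext => y; rewrite fix_map_funE !fix_normE rmorph_prod.
by apply: eq_bigr => x _; rewrite fix_map_funE.
Qed.

Definition fix_map : tambara_map (fix_tambara S) (fix_tambara T) :=
  @TambaraMap gT (fix_tambara S) (fix_tambara T) (fun X => @fix_map_fun X)
    fix_map_res fix_map_tr fix_map_norm.

End FixedPointsMap.

(* The constant Tambara functor R^c is the fixed point functor of R with the  *)
(* trivial action: R^c(G/H) = R, restrictions between orbits are identities,  *)
(* and the transfer and norm along G/H -> G/K are a |-> #|K : H| a and        *)
(* a |-> a ^ #|K : H|.                                                        *)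
Definition trivial_gring (gT : finGroupType) (R : comPzRingType) : gring gT :=
  @GRingAct gT R (fun _ => idfun : {rmorphism R -> R})
    (fun _ => erefl) (fun _ _ _ => erefl).

Definition const_tambara (gT : finGroupType) (R : comPzRingType) : tambara gT :=
  fix_tambara (trivial_gring gT R).

Definition C2 : finGroupType := 'Z_2.

Section GaloisExtension.
Variables (K : fieldType) (L : splittingFieldType K).
Variable c : {morphism [set: C2] >-> gal_of {:L}}.

Definition galois_act (g : C2) : {rmorphism L -> L} := gal_repr (c g).

Lemma galois_act1 a : galois_act 1%g a = a.
Proof.
by rewrite /galois_act morph1; exact: gal_id.
Qed.
Lemma galois_actM g h a :
  galois_act (g * h)%g a = galois_act h (galois_act g a).
Proof.
rewrite /galois_act (morphM c) ?inE //; apply: galM; exact: memvf.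
Qed.

Definition galois_gring : gring C2 :=
  @GRingAct C2 L galois_act galois_act1 galois_actM.

Lemma in_algJ g (a : K) :
  in_alg L (gring_act (trivial_gring C2 K) g a) =
  gring_act galois_gring g (in_alg L a).
Proof.
rewrite /= /galois_act; apply/esym; apply: etrans (linearZZ _ a 1) _.
by rewrite rmorph1.
Qed.

Definition const_to_fix :
    tambara_map (const_tambara C2 K) (fix_tambara galois_gring) :=
  fix_map (S := trivial_gring C2 K) (T := galois_gring) in_algJ.

End GaloisExtension.

(* Main.v *)
(* L has a normal K-basis [act g alpha] with a trace-dual normal basis        *)
(* [act g beta]. So L^fix is free over K^c on one generator at the level      *)
(* C_2/e: (L^fix [] M)(X) is M (X x C_2), naturally in M, which is exact.     *)
(* With M := L^fix this also identifies L^fix [] L^fix with the fixed point   *)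
(* functor of the ring of functions from C_2 to L, whence its norms.          *)
(* The separability idempotent [sum_g act g alpha (x) act g beta], a transfer *)
(* from X x C_2, satisfies s p = s (mult p (x) 1). So p = (1 - s) p for p in  *)
(* I, with 1 - s in I, and a product of two elements of I is the norm, along  *)
(* the 2-surjective fold map X + X -> X, of an element of I (X + X).          *)
From HB Require Import structures.
Require Import Defs.
From mathcomp Require Import all_boot all_order all_algebra all_fingroup.
From mathcomp Require Import all_solvable all_field.
From mathcomp Require Import boolp freeg.
(* mathcomp has its own [gact], for group actions on groups. *)
Import Defs.

Set Implicit Arguments.
Unset Strict Implicit.
Unset Printing Implicit Defensive.

Import GRing.Theory.
Local Open Scope ring_scope.
Local Open Scope quotient_scope.

(** By trace duality each t in L equals sum_g Tr(t g(beta)) g(alpha). Read on X x C_2, this writes t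
    as the transfer of a K-valued function times one fixed generator ([coordK]), while the
    coordinates of that generator are the indicator of the diagonal ([coord_orbit]). So [unfold] and
    [refold] are inverse natural isomorphisms between (L^fix [] M)(X) and M(X x C_2), and flatness
    follows since exactness is levelwise ([fix_flat]). For the differentials, s = sum_g g(alpha) (x)
    g(beta) satisfies s (t (x) 1) = s (1 (x) t) and multiplies to 1 ([sep_elt_mul], [sep_elt_aug]).
    Hence each p in I is the product (1 - s) p of two elements of I, and [norm_gfold] makes such a
    product a norm. Nothing is divided by 2: the dual basis only requires some a with tau(a)^2 !=
    a^2, and such an a exists in every characteristic ([galois_normal_basis]). *)

(** * Box product generators over arbitrary finite G-sets *)

Section Enumeration.
Variables (gT : finGroupType) (X : gset gT).

Definition enum_act (i : 'I_#|X|) (g : gT) : 'I_#|X| :=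
  enum_rank (gact X (enum_val i) g).
Lemma enum_act1 : enum_act^~ 1%g =1 id.
Proof. by move=> i; rewrite /enum_act act1 enum_valK. Qed.
Lemma enum_actM i : act_morph enum_act i.
Proof. by move=> g h; rewrite /enum_act enum_rankK actM. Qed.
Definition enum_gset : ogset gT := OGSet (TotalAction enum_act1 enum_actM).

Lemma enum_valJ (i : enum_gset) g :
  enum_val (gact enum_gset i g) = gact X (enum_val i) g.
Proof. exact: enum_rankK. Qed.
Definition gval : gmap enum_gset X := GMap enum_valJ.

Lemma enum_rankJ (x : X) g :
  enum_rank (gact X x g) = gact enum_gset (enum_rank x) g.
Proof. by rewrite /= /enum_act enum_rankK. Qed.
Definition grank : gmap X enum_gset := GMap (Y := enum_gset) enum_rankJ.

Lemma grankK : gcomp gval grank = gid X.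
Proof. by apply: gmapP => x; apply: enum_rankK. Qed.

End Enumeration.

Section MackeyFacts.
Variables (gT : finGroupType) (M : mackey gT).
Implicit Types X Y : gset gT.

(** [gval X] is an isomorphism, so base change turns its transfer into restriction along the inverse
    [grank X]. *)
Lemma mtr_res_gval X (m : M X) : mtr M (gval X) (mres M (gval X) m) = m.
Proof.
have P := mackeyP M.
have pb : pullback (grank X) (gid X) (gval X) (gid X).
  split=> [w|x y /= xy]; first exact: enum_rankK.
  by exists y; split=> [|w [_ <-]] //; rewrite -xy /= enum_valK.
rewrite -[LHS](ax_res_id P) (ax_base_change P pb) (ax_tr_id P).
by rewrite -(ax_res_comp P) grankK (ax_res_id P).
Qed.

Definition enum_gmap X Y (k : gmap X Y) : gmap (enum_gset X) (enum_gset Y) :=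
  gcomp (grank Y) (gcomp k (gval X)).

Lemma gval_enum_gmap X Y (k : gmap X Y) :
  gcomp (gval Y) (enum_gmap k) = gcomp k (gval X).
Proof. by apply: gmapP => i /=; rewrite enum_rankK. Qed.

Lemma mres_gval_tr X Y (k : gmap X Y) (m : M X) :
  mres M (gval Y) (mtr M k m) = mtr M (enum_gmap k) (mres M (gval X) m).
Proof.
apply: (ax_base_change (mackeyP M)); split=> [w|x y /= kx].
  by rewrite /= enum_rankK.
exists (enum_rank x); split=> [|w [/= <- _]]; last by rewrite enum_valK.
by rewrite /= enum_rankK kx enum_valK.
Qed.

End MackeyFacts.

(* [U, f, m (x) n] for an arbitrary finite G-set U, through an enumeration of *)
(* U.                                                                         *)
Section RelboxGenerators.
Variables (gT : finGroupType) (R : green gT) (M N : gmodule R) (X : gset gT).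

Definition relbox_gen (U : gset gT) (f : gmap U X) (m : M U) (n : N U) :
    relbox M N X :=
  relbox_class (gcomp f (gval U)) (mres M (gval U) m) (mres N (gval U) n).

Lemma relbox_genDr U (f : gmap U X) m n1 n2 :
  relbox_gen f m (n1 + n2) = relbox_gen f m n1 + relbox_gen f m n2.
Proof. by rewrite /relbox_gen raddfD relbox_classDr. Qed.

Lemma relbox_genFl U V (k : gmap U V) (f : gmap V X) m n :
  relbox_gen f (mtr M k m) n = relbox_gen (gcomp f k) m (mres N k n).
Proof.
rewrite /relbox_gen mres_gval_tr relbox_classFl.
rewrite -!(ax_res_comp (mackeyP N)) gval_enum_gmap; congr relbox_class.
by apply: gmapP => i /=; rewrite enum_rankK.
Qed.

Lemma relbox_genFr U V (k : gmap U V) (f : gmap V X) m n :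
  relbox_gen f m (mtr N k n) = relbox_gen (gcomp f k) (mres M k m) n.
Proof.
rewrite /relbox_gen mres_gval_tr relbox_classFr.
rewrite -!(ax_res_comp (mackeyP M)) gval_enum_gmap; congr relbox_class.
by apply: gmapP => i /=; rewrite enum_rankK.
Qed.

Lemma relbox_gen_bal U (f : gmap U X) m (r : R U) n :
  relbox_gen f (gscale M r m) n = relbox_gen f m (gscale N r n).
Proof. by rewrite /relbox_gen !gscale_res relbox_class_bal. Qed.

Lemma relbox_gen_class (U : ogset gT) (f : gmap U X) (m : M U) (n : N U) :
  relbox_gen f m n = relbox_class f m n.
Proof. by rewrite -[in RHS](mtr_res_gval m) relbox_classFl. Qed.

(** Every element is represented by an integer combination of free generators, and a subgroup
    contains all such combinations. *)
Lemma relbox_ind (P : relbox M N X -> Prop) :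
  subgroup_pred P ->
  (forall (U : ogset gT) (f : gmap U X) m n, P (relbox_class f m n)) ->
  forall z, P z.
Proof.
move=> [P0 PB] Pcls.
have PN z : P z -> P (- z) by rewrite -sub0r; apply: PB.
have PD y z : P y -> P z -> P (y + z).
  by move=> Py Pz; rewrite -[z]opprK; apply/PB/PN.
have PM z n : P z -> P (z *+ n).
  by move=> Pz; elim: n => // n IHn; rewrite mulrS; apply: PD.
have Pfree (w : box_free M N X) :
    P (\pi_(quot (span (@coeq_rel _ R M N X)))
        (\pi_(quot (span (@box_rel _ M N X))) w)).
  elim/freeg_ind_dom0: w => [|k x w _ _ Pw]; first by rewrite !raddf0.
  rewrite !raddfD; apply: PD => //.
  have Px : P (\pi_(quot (span (@coeq_rel _ R M N X)))
        (\pi_(quot (span (@box_rel _ M N X))) (<< x >> : box_free M N X))).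
    by case: x => U f m n; apply: Pcls.
  have -> : << k *g x >> = (<< x >> : box_free M N X) *~ k.
    by rewrite freegU_mulz intz.
  case: k => n; first by rewrite -pmulrn 2!raddfMn; apply: PM.
  by rewrite NegzE mulrNz -pmulrn 2!raddfN 2!raddfMn; apply/PN/PM.
by move=> z; rewrite -[z]reprK -[generic_quotient.repr z]reprK; apply: Pfree.
Qed.

Lemma relbox_additive_eq (W : zmodType) (h k : {additive relbox M N X -> W}) :
  (forall (U : ogset gT) (f : gmap U X) m n,
     h (relbox_class f m n) = k (relbox_class f m n)) -> h =1 k.
Proof.
move=> hk; apply: relbox_ind => //; split=> [|y z ey ez]; rewrite ?raddf0 //.
by rewrite !raddfB ey ez.
Qed.

End RelboxGenerators.

(** * The functor X |-> X x G on finite G-sets *)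

Section FreeGset.
Variable gT : finGroupType.
Implicit Types X Y : gset gT.

Section Times.
Variable X : gset gT.
Definition times_act (z : X * gT) (g : gT) : X * gT :=
  (gact X z.1 g, (z.2 * g)%g).
Lemma times_act1 : times_act^~ 1%g =1 id.
Proof. by case=> x h; rewrite /times_act act1 mulg1. Qed.
Lemma times_actM z : act_morph times_act z.
Proof. by move=> g h; rewrite /times_act /= actM mulgA. Qed.
Definition gtimes : gset gT :=
  GSet (X * gT)%type (TotalAction times_act1 times_actM).
Definition gfst : gmap gtimes X := @GMap gT gtimes X fst (fun _ _ => erefl).
End Times.

(** A common section of the two projections [gfst (gtimes X)] and [gtimes_map (gfst X)]. *)
Definition gdiag X : gmap (gtimes X) (gtimes (gtimes X)) :=
  @GMap gT (gtimes X) (gtimes (gtimes X)) (fun z => (z, z.2))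
    (fun _ _ => erefl).

Lemma gtimes_mapJ X Y (f : gmap X Y) (z : gtimes X) g :
  (f (gact (gtimes X) z g).1, (gact (gtimes X) z g).2) =
  gact (gtimes Y) (f z.1, z.2) g.
Proof. by rewrite /= /times_act gfunJ. Qed.
Definition gtimes_map X Y (f : gmap X Y) : gmap (gtimes X) (gtimes Y) :=
  GMap (X := gtimes X) (Y := gtimes Y) (gtimes_mapJ f).

Lemma gtimes_map_comp X Y Z (g : gmap Y Z) (f : gmap X Y) :
  gtimes_map (gcomp g f) = gcomp (gtimes_map g) (gtimes_map f).
Proof. exact: gmapP. Qed.

Lemma gfst_map X Y (f : gmap X Y) :
  gcomp (gfst Y) (gtimes_map f) = gcomp f (gfst X).
Proof. exact: gmapP. Qed.

Lemma pullback_gfst X Y (f : gmap X Y) :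
  pullback (gfst X) (gtimes_map f) f (gfst Y).
Proof.
split=> // x [y g] /= fx; exists (x, g).
by rewrite -fx; split=> [|[x' g'] [/= -> [->]]].
Qed.

Lemma pullback_gfst_tr X Y (f : gmap X Y) :
  pullback (gtimes_map f) (gfst X) (gfst Y) f.
Proof.
split=> // -[y g] x /= fx; exists (x, g).
by rewrite fx; split=> [|[x' g'] [/= [_ ->] ->]] //=; rewrite fx.
Qed.

Lemma mtr_gdiag (M : mackey gT) X (m : M (gtimes X)) :
  mtr M (gtimes_map (gfst X)) (mtr M (gdiag X) m) = m.
Proof.
rewrite -(ax_tr_comp (mackeyP M)) -[RHS](ax_tr_id (mackeyP M)).
by congr (mtr M _ _); apply: gmapP => -[].
Qed.

Lemma mres_gdiag (M : mackey gT) X (m : M (gtimes X)) :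
  mres M (gdiag X) (mres M (gfst (gtimes X)) m) = m.
Proof.
rewrite -(ax_res_comp (mackeyP M)) -[RHS](ax_res_id (mackeyP M)).
by congr (mres M _ _); apply: gmapP => -[].
Qed.

End FreeGset.

Section Pairing.
Variables (gT : finGroupType) (R T P : tambara gT) (phi : tambara_map R T).
Variables (i1 i2 : tambara_map T P).
Hypothesis i12 : forall X (r : R X), i1 X (phi X r) = i2 X (phi X r).
Local Notation TR := (restrict_scalars phi).

Lemma box_pairing_gen X (U : gset gT) (f : gmap U X) (a b : T U) :
  box_pairing i12 X (relbox_gen (M := TR) (N := TR) f a b) =
  gtr P f (i1 U a * i2 U b).
Proof.
rewrite relbox_liftE /pairing (ax_tr_comp (gmackeyP P)) /= !tmap_res -rmorphM.
by congr (gtr P f _); apply: (mtr_res_gval (M := green_mackey P)).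
Qed.

End Pairing.

(** * The function ring that models T (x)_K T *)

HB.instance Definition _ (aT : finType) (R : comPzRingType) :=
  GRing.PzRing_hasCommutativeMul.Build {ffun aT -> R} (@ffun_mulC aT R).

(* For a Galois extension T of K with abelian group G, a (x) b |->            *)
(* (g |-> a g(b)) identifies T (x)_K T, with the diagonal action, with the    *)
(* ring of functions from G to T.                                             *)
Section FunctionRing.
Variables (gT : finGroupType) (T : gring gT).
Hypothesis gmulC : commutative (@mulg gT).

Section Act.
Variable g : gT.
Definition ffun_act (F : {ffun gT -> T}) : {ffun gT -> T} :=
  [ffun h => gring_act T g (F h)].
Lemma ffun_act_zmod : zmod_morphism ffun_act.
Proof. by move=> F G; apply/ffunP => h; rewrite !ffunE rmorphB. Qed.
Lemma ffun_act_monoid : monoid_morphism ffun_act.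
Proof.
by split=> [|F G]; apply/ffunP => h; rewrite !ffunE (rmorph1, rmorphM).
Qed.
HB.instance Definition _ :=
  GRing.isZmodMorphism.Build _ _ ffun_act ffun_act_zmod.
HB.instance Definition _ :=
  GRing.isMonoidMorphism.Build _ _ ffun_act ffun_act_monoid.

End Act.

Lemma ffun_act1 F : ffun_act 1%g F = F.
Proof. by apply/ffunP => h; rewrite ffunE gring_act1. Qed.
Lemma ffun_actM g h F : ffun_act (g * h)%g F = ffun_act h (ffun_act g F).
Proof. by apply/ffunP => k; rewrite !ffunE gring_actM. Qed.
Definition ffun_gring : gring gT :=
  @GRingAct gT {ffun gT -> T} ffun_act ffun_act1 ffun_actM.

Definition ffun_cst (a : T) : {ffun gT -> T} := [ffun=> a].
Lemma ffun_cst_zmod : zmod_morphism ffun_cst.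
Proof. by move=> a b; apply/ffunP => h; rewrite !ffunE. Qed.
Lemma ffun_cst_monoid : monoid_morphism ffun_cst.
Proof. by split=> [|a b]; apply/ffunP => h; rewrite !ffunE. Qed.
HB.instance Definition _ :=
  GRing.isZmodMorphism.Build T {ffun gT -> T} ffun_cst ffun_cst_zmod.
HB.instance Definition _ :=
  GRing.isMonoidMorphism.Build T {ffun gT -> T} ffun_cst ffun_cst_monoid.

Definition ffun_orbit (a : T) : {ffun gT -> T} := [ffun g => gring_act T g a].
Lemma ffun_orbit_zmod : zmod_morphism ffun_orbit.
Proof. by move=> a b; apply/ffunP => h; rewrite !ffunE rmorphB. Qed.
Lemma ffun_orbit_monoid : monoid_morphism ffun_orbit.
Proof.
by split=> [|a b]; apply/ffunP => h; rewrite !ffunE (rmorph1, rmorphM).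
Qed.
HB.instance Definition _ :=
  GRing.isZmodMorphism.Build T {ffun gT -> T} ffun_orbit ffun_orbit_zmod.
HB.instance Definition _ :=
  GRing.isMonoidMorphism.Build T {ffun gT -> T} ffun_orbit ffun_orbit_monoid.

Lemma ffun_cstJ g (a : T) :
  ffun_cst (gring_act T g a) = gring_act ffun_gring g (ffun_cst a).
Proof. by apply/ffunP => h; rewrite !ffunE. Qed.
(** Commutativity of the group lets [g] pass through the action of each argument [h]. *)
Lemma ffun_orbitJ g (a : T) :
  ffun_orbit (gring_act T g a) = gring_act ffun_gring g (ffun_orbit a).
Proof. by apply/ffunP => h; rewrite !ffunE -!gring_actM gmulC. Qed.

Definition ffun_inl : tambara_map (fix_tambara T) (fix_tambara ffun_gring) :=
  fix_map (S := T) (T := ffun_gring) (j := ffun_cst) ffun_cstJ.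
Definition ffun_inr : tambara_map (fix_tambara T) (fix_tambara ffun_gring) :=
  fix_map (S := T) (T := ffun_gring) (j := ffun_orbit) ffun_orbitJ.

End FunctionRing.

(** * Products as norms along fold maps *)

Section NormFold.
Variables (gT : finGroupType) (P : tambara gT).
Implicit Types X Y : gset gT.

Definition gfold_fun X (z : gsum X X) : X :=
  match z with inl x | inr x => x end.
Lemma gfoldJ X (z : gsum X X) g :
  gfold_fun (gact (gsum X X) z g) = gact X (gfold_fun z) g.
Proof. by case: z. Qed.
Definition gfold X : gmap (gsum X X) X := GMap (@gfoldJ X).

Lemma gfold_two_surjective X : two_surjective (gfold X).
Proof.
move=> x; rewrite (cardsD1 (inl x)) (cardsD1 (inr x)) !inE /=.
by rewrite !eqxx.
Qed.

Lemma void_actJ X (v : gempty gT) g :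
  of_void X (gact (gempty gT) v g) = gact X (of_void X v) g.
Proof. by case: v. Qed.
Definition gvoid X : gmap (gempty gT) X := GMap (@void_actJ X).

Lemma pullback_id X Y (f : gmap X Y) :
  injective f -> pullback (gid X) (gid X) f f.
Proof.
move=> f_inj; split=> // x y /f_inj <-.
by exists x; split=> // w [].
Qed.

Lemma pullback_disjoint X Y Z (f : gmap X Z) (g : gmap Y Z) :
  (forall x y, f x <> g y) -> pullback (gvoid X) (gvoid Y) f g.
Proof. by move=> fg; split=> [[]|x y /fg]. Qed.

Let M := gmackeyP P.
Let N := tambaraP P.

Lemma gres_tr_inj X Y (f : gmap X Y) (a : P X) :
  injective f -> gres P f (gtr P f a) = a.
Proof.
move=> /pullback_id pb.
by rewrite (ax_base_change M pb) (ax_tr_id M) (ax_res_id M).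
Qed.

Lemma gres_norm_inj X Y (f : gmap X Y) (a : P X) :
  injective f -> gres P f (tnorm P f a) = a.
Proof.
move=> /pullback_id pb.
by rewrite (ax_norm_base_change N pb) (ax_norm_id N) (ax_res_id M).
Qed.

Lemma gres_tr_disjoint X Y Z (f : gmap X Z) (g : gmap Y Z) (a : P X) :
  (forall x y, f x <> g y) -> gres P g (gtr P f a) = 0.
Proof.
move=> /pullback_disjoint pb.
by rewrite (ax_base_change M pb) [gres _ _ _](ax_empty M) raddf0.
Qed.

Lemma gres_norm_disjoint X Y Z (f : gmap X Z) (g : gmap Y Z) (a : P X) :
  (forall x y, f x <> g y) -> gres P g (tnorm P f a) = 1.
Proof.
move=> /pullback_disjoint pb; rewrite (ax_norm_base_change N pb).
(* [P (gempty gT)] is the zero ring, so the restricted element may be replaced by 1, whose norm is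
   1. *)
rewrite [gres _ _ _](ax_empty M) -(ax_empty M (1 : P (gempty gT))).
exact: ax_norm1.
Qed.

(** The element with components (a, b) is the product of the norms of [a] and [b] along the two
    inclusions, which have components (a, 1) and (1, b); functoriality of norms then suffices. *)
Lemma norm_gfold X (a b : P X) :
  tnorm P (gfold X) (gtr P (ginl X X) a + gtr P (ginr X X) b) = a * b.
Proof.
have inl_inj : injective (ginl X X) by move=> x y [].
have inr_inj : injective (ginr X X) by move=> x y [].
have lr x y : ginl X X x <> ginr X X y by [].
have rl x y : ginr X X x <> ginl X X y by [].
have -> : gtr P (ginl X X) a + gtr P (ginr X X) b =
    tnorm P (ginl X X) a * tnorm P (ginr X X) b.
  apply: (bij_inj (ax_sum M X X)); congr pair.
    rewrite rmorphD rmorphM /= gres_tr_inj // gres_norm_inj //.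
    by rewrite gres_tr_disjoint // gres_norm_disjoint // addr0 mulr1.
  rewrite rmorphD rmorphM /= gres_tr_inj // gres_norm_inj //.
  by rewrite gres_tr_disjoint // gres_norm_disjoint // add0r mul1r.
rewrite (ax_normM N) -!(ax_norm_comp N).
have -> : gcomp (gfold X) (ginl X X) = gid X by apply: gmapP.
have -> : gcomp (gfold X) (ginr X X) = gid X by apply: gmapP.
by rewrite !(ax_norm_id N).
Qed.

End NormFold.

(** * A criterion for the vanishing of Kaehler differentials *)

Section KaehlerVanishing.
Variables (gT : finGroupType) (R T : tambara gT) (phi : tambara_map R T).
Variable B : tambara_box phi.
Local Notation aug X := (@aug_ideal _ _ _ phi B X).

Lemma aug_ideal_tr X Y (f : gmap X Y) p : p \in aug X -> gtr B f p \in aug Y.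
Proof.
(* Here [y] is the transfer of [z] in the box product: it replaces [k] by [gcomp f k] in each
   generator. *)
have lift z : exists2 y, box_mult phi Y y = gtr T f (box_mult phi X z)
    & box_pairing (@tbox_compat _ _ _ _ B) Y y =
      gtr B f (box_pairing (@tbox_compat _ _ _ _ B) X z).
  move: z; apply: relbox_ind => [|U k a b].
    split=> [|y z [y' ym yp] [z' zm zp]].
      by exists 0; rewrite !raddf0.
    by exists (y' - z'); rewrite !raddfB (ym, yp) (zm, zp).
  exists (relbox_class (gcomp f k) a b).
    by rewrite /box_mult !relbox_liftE; apply: (ax_tr_comp (gmackeyP T)).
  by rewrite !relbox_liftE; apply: (ax_tr_comp (gmackeyP B)).
case/asboolP => z z0 <-; have [y ym yp] := lift z.
by apply/asboolP; exists y => //; rewrite ym z0 raddf0.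
Qed.

Lemma aug_ideal_mul_norm X a b :
  a \in aug X -> b \in aug X -> a * b \in @norm_ideal _ _ _ phi B X.
Proof.
move=> Ia Ib; apply/asboolP => J _ JN; rewrite -norm_gfold.
apply: JN; first exact: gfold_two_surjective.
by apply: rpredD; apply: aug_ideal_tr.
Qed.

Lemma kaehler_eq0 X (w : kaehler B X) :
  (forall p, p \in aug X ->
     exists2 a, a \in aug X & exists2 b, b \in aug X & p = a * b) ->
  w = 0.
Proof.
move=> aug_sq; rewrite -[w]reprK.
set p := generic_quotient.repr w.
transitivity (\pi_(quot (@norm_ideal_in _ _ _ phi B X)) 0); last first.
  by rewrite raddf0.
apply/eqP; rewrite -Quotient.idealrBE subr0.
have [a Ia [b Ib pE]] := aug_sq _ (valP p).
by rewrite /norm_ideal_in unfold_in pE; apply: aug_ideal_mul_norm.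
Qed.

End KaehlerVanishing.

(** * Trace-dual normal bases *)

Section NormalBasis.
Variables (gT : finGroupType) (K : comPzRingType) (T : gring gT).
Variables (j : {rmorphism K -> T}) (tr : T -> K) (alpha beta : T).
Local Notation act := (gring_act T).
Implicit Types X Y : gset gT.
Hypothesis jJ : forall g a,
  j (gring_act (trivial_gring gT K) g a) = act g (j a).
Hypothesis j_inj : injective j.
Hypothesis trE : forall a, j (tr a) = \sum_g act g a.
Hypothesis dual : forall g h,
  tr (act g alpha * act h beta) = (g == h)%:R.
Hypothesis gmulC : commutative (@mulg gT).

Lemma trD a b : tr (a + b) = tr a + tr b.
Proof.
apply: j_inj; rewrite rmorphD !trE -big_split.
by apply: eq_bigr => g _; rewrite rmorphD.
Qed.
Lemma tr_sum I (r : seq I) (P : pred I) (F : I -> T) :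
  tr (\sum_(i <- r | P i) F i) = \sum_(i <- r | P i) tr (F i).
Proof.
apply: j_inj; rewrite trE rmorph_sum.
under eq_bigr do rewrite rmorph_sum.
by rewrite exchange_big; apply: eq_bigr => i _; rewrite trE.
Qed.
Lemma trZ a b : tr (j a * b) = a * tr b.
Proof.
apply: j_inj; rewrite rmorphM !trE mulr_sumr.
by apply: eq_bigr => g _; rewrite rmorphM -jJ.
Qed.
Lemma tr_act g a : tr (act g a) = tr a.
Proof.
apply: j_inj; rewrite !trE [RHS](reindex_inj (mulgI g)).
by apply: eq_bigr => h _; rewrite gring_actM.
Qed.

Lemma actC g h a : act g (act h a) = act h (act g a).
Proof. by rewrite -!gring_actM gmulC. Qed.

(** This is [dual] at [1%g] and [g], with the trace written as a sum and the commuting actions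
    exchanged. *)
Lemma orthogonality g :
  \sum_h act h alpha * act g (act h beta) = (g == 1%g)%:R.
Proof.
rewrite eq_sym -[LHS](_ : j (tr (act 1%g alpha * act g beta)) = _).
  by rewrite dual rmorph_nat.
rewrite trE; apply: eq_bigr => h _.
by rewrite rmorphM gring_act1 actC.
Qed.

(** With the trace written as a sum over [k], summing over [g] first makes [orthogonality] kill
    every term except [k = 1]. *)
Lemma expand_alpha a : \sum_g j (tr (a * act g beta)) * act g alpha = a.
Proof.
under eq_bigr do rewrite trE mulr_suml.
rewrite exchange_big (bigD1 1%g) //= [X in _ + X]big1 ?addr0 => [|k k1].
  under eq_bigr do rewrite !gring_act1 -mulrA.
  rewrite -mulr_sumr; transitivity (a * (1%g == 1%g :> gT)%:R).
    rewrite -orthogonality; congr (_ * _); apply: eq_bigr => g _.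
    by rewrite mulrC gring_act1.
  by rewrite eqxx mulr1.
under eq_bigr do rewrite rmorphM -mulrA [_ * act _ alpha]mulrC.
by rewrite -mulr_sumr orthogonality (negPf k1) mulr0.
Qed.

Lemma expand_beta a : \sum_g j (tr (act g alpha * a)) * act g beta = a.
Proof.
under eq_bigr do rewrite trE mulr_suml.
rewrite exchange_big (bigD1 1%g) //= [X in _ + X]big1 ?addr0 => [|k k1].
  under eq_bigr do rewrite gring_act1 mulrAC mulrC.
  rewrite -mulr_sumr; transitivity (a * (1%g == 1%g :> gT)%:R).
    rewrite -orthogonality; congr (_ * _); apply: eq_bigr => g _.
    by rewrite gring_act1.
  by rewrite eqxx mulr1.
(* Pulling [act k] out leaves [orthogonality] at the inverse of [k]. *)
transitivity (act k (a * \sum_g act g alpha * act k^-1 (act g beta))).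
  rewrite mulr_sumr rmorph_sum; apply: eq_bigr => g _.
  rewrite !rmorphM -[act k (act k^-1 _)]gring_actM mulVg gring_act1 mulrA.
  by rewrite [act k a * _]mulrC.
by rewrite orthogonality invg_eq1 (negPf k1) mulr0 rmorph0.
Qed.

(** * Coordinates of T^fix over K^c *)

Local Notation KG := (const_tambara gT K).
Local Notation TG := (fix_tambara T).
Local Notation phi := (fix_map jJ).
Local Notation TK := (restrict_scalars phi).

Section Orbit.
Variables (a : T) (X : gset gT).
Lemma orbit_subproof :
  [ffun z : gtimes X => act z.2 a] \in @equivariant _ T (gtimes X).
Proof. by apply/equivariantP => -[x h] g; rewrite !ffunE gring_actM. Qed.
(** Equivariant functions on X x G are arbitrary functions on X x {1}; this one extends the constant
    [a]. *)
Definition orbit_fun : fix_obj T (gtimes X) :=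
  exist _ [ffun z : gtimes X => act z.2 a] orbit_subproof.
Lemma orbit_funE z : fix_val orbit_fun z = act z.2 a.
Proof. by rewrite /fix_val /= ffunE. Qed.
End Orbit.

Lemma orbit_fun_res a X Y (f : gmap X Y) :
  fix_res (gtimes_map f) (orbit_fun a Y) = orbit_fun a X.
Proof. by apply: fix_ext => z; rewrite fix_resE !orbit_funE. Qed.

Section Coord.
Variables (X : gset gT) (t : fix_obj T X).
Lemma coord_subproof :
  [ffun z : gtimes X => tr (fix_val t z.1 * act z.2 beta)]
    \in @equivariant _ (trivial_gring gT K) (gtimes X).
Proof.
apply/equivariantP => -[x h] g; rewrite !ffunE /= fix_valJ gring_actM.
by rewrite -rmorphM tr_act.
Qed.
Definition coord : fix_obj (trivial_gring gT K) (gtimes X) :=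
  exist _ [ffun z : gtimes X => tr (fix_val t z.1 * act z.2 beta)]
    coord_subproof.
Lemma coordE z : fix_val coord z = tr (fix_val t z.1 * act z.2 beta).
Proof. by rewrite /fix_val /= ffunE. Qed.
End Coord.

Lemma sum_gfst (X : gset gT) (F : gtimes X -> T) x :
  \sum_(z | gfst X z == x) F z = \sum_g F (x, g).
Proof.
transitivity (\sum_(y | y == x) \sum_g F (y, g)); last by rewrite big_pred1_eq.
rewrite pair_big; apply: eq_big => [z|[y g] _] //=.
by rewrite andbT.
Qed.

Lemma coordK X (t : fix_obj T X) :
  fix_tr (gfst X) (fix_map_fun jJ (coord t) * orbit_fun alpha X) = t.
Proof.
apply: fix_ext => x; rewrite fix_trE sum_gfst -[RHS]expand_alpha.
by apply: eq_bigr => g _; rewrite fix_valM fix_map_funE coordE orbit_funE.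
Qed.

Lemma coordD X (t u : fix_obj T X) : coord (t + u) = coord t + coord u.
Proof.
by apply: fix_ext => z; rewrite fix_valD !coordE fix_valD mulrDl trD.
Qed.

Lemma coordZ X (r : KG X) (t : fix_obj T X) :
  coord (fix_map_fun jJ r * t) = fix_res (gfst X) r * coord t.
Proof.
apply: fix_ext => z; rewrite fix_valM !coordE fix_resE fix_valM fix_map_funE.
by rewrite -mulrA trZ.
Qed.

Lemma coord_res X Y (f : gmap X Y) (t : fix_obj T Y) :
  coord (fix_res f t) = fix_res (gtimes_map f) (coord t).
Proof. by apply: fix_ext => z; rewrite fix_resE !coordE fix_resE. Qed.

Lemma coord_tr X Y (f : gmap X Y) (t : fix_obj T X) :
  coord (fix_tr f t) = fix_tr (gtimes_map f) (coord t).
Proof.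
apply: fix_ext => -[y g]; rewrite fix_trE coordE fix_trE mulr_suml tr_sum.
rewrite -[y]/(gfst Y (y, g)) (pullback_big (pullback_gfst f)).
by apply: eq_bigr => -[x h] /eqP[_ hg]; rewrite coordE /= hg.
Qed.

(** By duality the coordinates form the indicator of the diagonal; this is the freeness of the
    generator. *)
Lemma coord_orbit X :
  coord (orbit_fun alpha X) = fix_tr (gdiag X) 1.
Proof.
apply: fix_ext => -[[x g] h]; rewrite coordE orbit_funE fix_trE /= dual.
under eq_bigr do rewrite fix_val1.
rewrite sumr_const; case: eqP => [<-|gh].
  rewrite (eq_card1 (x := (x, g))) // => z.
  rewrite -[LHS]/((z == (x, g)) && (z.2 == g)) -[RHS]/(z == (x, g)).
  by case: eqP => [->|//]; rewrite eqxx.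
rewrite eq_card0 // => z; rewrite -[LHS]/((z == (x, g)) && (z.2 == h)).
by case: eqP => [->|//]; apply/eqP.
Qed.

(** * Flatness *)

Section Flat.
Variable M : gmodule KG.
Variable X : gset gT.

Definition unfold_gen (U : gset gT) (f : gmap U X) (t : TK U) (m : M U) :
    M (gtimes X) :=
  mtr M (gtimes_map f) (gscale M (coord t : KG (gtimes U)) (mres M (gfst U) m)).

(** Stated for all finite G-sets, so that it also handles [gval U] in [unfold_relbox_gen]. *)
Lemma unfold_genFl (U V : gset gT) (k : gmap U V) (f : gmap V X) t m :
  unfold_gen f (mtr TK k t) m = unfold_gen (gcomp f k) t (mres M k m).
Proof.
rewrite /unfold_gen (coord_tr k t) gtimes_map_comp (ax_tr_comp (mackeyP M)).
rewrite -[fix_tr _ _]/(gtr KG (gtimes_map k) (coord t)) -gtr_scale.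
by rewrite -!(ax_res_comp (mackeyP M)) gfst_map.
Qed.

Lemma unfold_compatible :
  box_compatible (M := TK) (N := M) (fun U : ogset gT => @unfold_gen U).
Proof.
split=> [U f t u m|U f t m n|U V k f t m|U V k f t n].
- by rewrite /unfold_gen coordD gscaleDl raddfD.
- by rewrite /unfold_gen raddfD gscaleDr raddfD.
- exact: unfold_genFl.
rewrite /unfold_gen (ax_base_change (mackeyP M) (pullback_gfst k)).
rewrite -gscale_tr gtimes_map_comp (ax_tr_comp (mackeyP M)).
by rewrite (coord_res k t).
Qed.

Lemma unfold_bal (U : ogset gT) (f : gmap U X) t (r : KG U) m :
  unfold_gen f (gscale TK r t) m = unfold_gen f t (gscale M r m).
Proof.
rewrite /unfold_gen gscale_res gscaleA (coordZ r t) mulrC.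
by [].
Qed.

(* T [] M is M (- x G), as T is free over K^c on alpha at the level G/e.      *)
Definition unfold : {additive relbox TK M X -> M (gtimes X)} :=
  relbox_lift unfold_compatible unfold_bal.

Lemma unfold_relbox_gen (U : gset gT) (f : gmap U X) t m :
  unfold (relbox_gen (M := TK) f t m) = unfold_gen f t m.
Proof.
by rewrite /unfold relbox_liftE -unfold_genFl mtr_res_gval.
Qed.

Definition refold (m : M (gtimes X)) : relbox TK M X :=
  relbox_gen (M := TK) (gfst X) (orbit_fun alpha X) m.

Lemma refoldB : zmod_morphism refold.
Proof.
move=> m n; apply/eqP; rewrite eq_sym subr_eq /refold -relbox_genDr.
by rewrite subrK.
Qed.
HB.instance Definition _ := GRing.isZmodMorphism.Build _ _ refold refoldB.

Lemma refoldK : cancel refold unfold.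
Proof.
move=> m; rewrite /refold unfold_relbox_gen /unfold_gen coord_orbit.
rewrite -[fix_tr _ _]/(gtr KG (gdiag X) 1) -gtr_scale gscale1.
by rewrite mtr_gdiag mres_gdiag.
Qed.

(** The Frobenius and balancing relations bring the coordinates back into the left factor, where
    [coordK] restores [t]. *)
Lemma unfoldK : cancel unfold refold.
Proof.
apply: (relbox_additive_eq (h := refold \o unfold) (k := idfun)) => U f t m.
rewrite -[LHS]/(refold (unfold _)) -[RHS]/(relbox_class f t m) relbox_liftE.
rewrite /unfold_gen /refold relbox_genFr.
rewrite -[mres TK _ _]/(fix_res (gtimes_map f) _) orbit_fun_res -relbox_gen_bal.
rewrite gfst_map -relbox_genFl -relbox_gen_class; congr relbox_gen.
exact: coordK.
Qed.

End Flat.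

Lemma unfold_map (M N : gmodule KG) (u : gmodule_map M N) X z :
  unfold N X (relbox_map TK u X z) = u (gtimes X) (unfold M X z).
Proof.
apply: (relbox_additive_eq (h := unfold N X \o relbox_map TK u X)
  (k := u (gtimes X) \o unfold M X)) => U f t m.
rewrite -[LHS]/(unfold N X (relbox_map TK u X _)).
rewrite -[RHS]/(u _ (unfold M X _)) 3!relbox_liftE.
by rewrite /unfold_gen mmap_tr mmap_scale mmap_res.
Qed.

Lemma fix_flat : flat TK.
Proof.
move=> M' M M'' i p ex X; have [i_inj kerE p_surj] := ex (gtimes X).
split=> [y z|z|z].
- move/(congr1 (@unfold M X)); rewrite !unfold_map => /i_inj.
  exact/can_inj/unfoldK.
- have unfold_eq (N : gmodule KG) (y w : relbox TK N X) :
      unfold N X y = unfold N X w -> y = w by apply/can_inj/unfoldK.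
  split=> [pz0|[y <-]].
    have /kerE[m im] : p (gtimes X) (unfold M X z) = 0.
      by rewrite -unfold_map pz0 raddf0.
    by exists (refold m); apply: unfold_eq; rewrite unfold_map refoldK.
  apply: unfold_eq; rewrite raddf0 !unfold_map; apply/kerE.
  by exists (unfold M' X y).
- have [m pm] := p_surj (unfold M'' X z); exists (refold m).
  apply: (can_inj (@unfoldK M'' X)).
  by rewrite unfold_map refoldK.
Qed.

(** * The Tambara structure on T [] T *)

Local Notation i1 := (ffun_inl T).
Local Notation i2 := (ffun_inr T gmulC).
Local Notation TS := (fix_tambara (ffun_gring T)).

Lemma ffun_compat X (r : KG X) : i1 X (phi X r) = i2 X (phi X r).
Proof.
apply: fix_ext => x; rewrite !fix_map_funE; apply/ffunP => h.
by rewrite !ffunE -jJ.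
Qed.

Local Notation pair X := (box_pairing (phi := phi) ffun_compat X).

Section FunctionCoord.
Variables (X : gset gT) (F : fix_obj (ffun_gring T) X).
(** For F(h) = a h(b), the image of a (x) b, the value at (x, g) is Tr(a g(beta)) b: the coordinate
    of the left factor, times b. *)
Definition ffun_coord_fun (z : gtimes X) : T :=
  \sum_k act k (act z.2 beta * (fix_val F z.1 : {ffun gT -> T}) k^-1%g).
Lemma ffun_coord_subproof :
  [ffun z => ffun_coord_fun z] \in @equivariant _ T (gtimes X).
Proof.
apply/equivariantP => -[x g] h; rewrite !ffunE /ffun_coord_fun rmorph_sum /=.
apply: eq_bigr => k _; rewrite actC fix_valJ ffunE.
by rewrite gring_actM -rmorphM.
Qed.
Definition ffun_coord : fix_obj T (gtimes X) :=
  exist _ [ffun z => ffun_coord_fun z] ffun_coord_subproof.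
Lemma ffun_coordE z : fix_val ffun_coord z = ffun_coord_fun z.
Proof. by rewrite /fix_val /= ffunE. Qed.
End FunctionCoord.

Lemma ffun_coord_zmod X : zmod_morphism (@ffun_coord X).
Proof.
move=> F G; apply: fix_ext => z; rewrite fix_valB !ffun_coordE -sumrB.
by apply: eq_bigr => k _; rewrite -rmorphB fix_valB !ffunE mulrBr.
Qed.
HB.instance Definition _ X := GRing.isZmodMorphism.Build
  (fix_obj (ffun_gring T) X) (fix_obj T (gtimes X))
  (@ffun_coord X) (@ffun_coord_zmod X).

Lemma ffun_coord_pair X z : ffun_coord (pair X z) = unfold TK X z.
Proof.
apply: (relbox_additive_eq (h := @ffun_coord X \o pair X)
  (k := unfold TK X)) => U f t m.
rewrite -[LHS]/(ffun_coord (pair X (relbox_class _ _ _))) 2!relbox_liftE.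
apply: fix_ext => -[x g]; rewrite ffun_coordE /ffun_coord_fun [RHS]fix_trE.
transitivity (\sum_(u | f u == gfst X (x, g))
    j (tr (fix_val (t : fix_obj T U) u * act g beta)) *
    fix_val (m : fix_obj T U) u); last first.
  rewrite (pullback_big (pullback_gfst f)).
  apply: eq_bigr => -[u h] /eqP[_ hg]; rewrite [RHS]fix_valM.
  by rewrite fix_map_funE coordE fix_resE /= hg.
rewrite fix_trE /=; under eq_bigr do rewrite sum_ffunE mulr_sumr rmorph_sum.
rewrite exchange_big; apply: eq_bigr => u _.
rewrite trE mulr_suml; apply: eq_bigr => k _.
rewrite fix_valM !fix_map_funE !ffunE !rmorphM.
rewrite -[act k (act k^-1 _)]gring_actM mulVg gring_act1.
by rewrite mulrCA mulrA.
Qed.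

Lemma pair_relbox_gen X (U : gset gT) (f : gmap U X) (a b : fix_obj T U) x h :
  (fix_val (pair X (relbox_gen (M := TK) (N := TK) f a b) : fix_obj _ X) x :
     {ffun gT -> T}) h =
  \sum_(u | f u == x) fix_val a u * act h (fix_val b u).
Proof.
rewrite box_pairing_gen fix_trE sum_ffunE; apply: eq_bigr => u _.
by rewrite fix_valM !fix_map_funE !ffunE.
Qed.

Lemma pair_bij X : bijective (pair X).
Proof.
exists (fun F => @refold TK X (ffun_coord F)) => [z|F].
  by rewrite ffun_coord_pair; apply: (@unfoldK TK X).
apply: fix_ext => x; apply/ffunP => h.
rewrite pair_relbox_gen sum_gfst.
transitivity (\sum_k \sum_g (act g alpha * act (k * h)%g (act g beta)) *
    act (k * h)%g ((fix_val F x : {ffun gT -> T}) k^-1%g)).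
  rewrite exchange_big; apply: eq_bigr => g _.
  rewrite orbit_funE ffun_coordE /ffun_coord_fun rmorph_sum mulr_sumr.
  by apply: eq_bigr => k _; rewrite -gring_actM rmorphM mulrA.
under eq_bigr do rewrite -mulr_suml orthogonality.
(* Only [k = h^-1] survives, and it contributes the value of [F] at [h]. *)
rewrite (bigD1 h^-1%g) //= [X in _ + X]big1 ?addr0 => [|k kh].
  by rewrite mulVg eqxx mul1r gring_act1 invgK.
case: eqP => [kh1|_]; last by rewrite mul0r.
by rewrite -(mulgK h k) kh1 mul1g eqxx in kh.
Qed.

Definition fix_tambara_box : tambara_box phi :=
  TambaraBox (tbox := TS) (tbox_inl := ffun_inl T)
    (tbox_inr := ffun_inr T gmulC) pair_bij.

(** * The separability idempotent *)

Section Kaehler.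
Variable B : tambara_box phi.
Local Notation l := (tbox_inl B).
Local Notation r := (tbox_inr B).

Definition sep_elt X : B X :=
  gtr B (gfst X) (l _ (orbit_fun alpha X) * r _ (orbit_fun beta X)).

Lemma sep_elt_res X Y (f : gmap X Y) : gres B f (sep_elt Y) = sep_elt X.
Proof.
rewrite /sep_elt (ax_base_change (gmackeyP B) (pullback_gfst_tr f)).
by rewrite rmorphM -!tmap_res /= !orbit_fun_res.
Qed.

Lemma orbit_beta_res X (t : fix_obj T X) :
  fix_res (gfst X) t * orbit_fun beta X =
  fix_tr (gtimes_map (gfst X))
    (fix_map_fun jJ (coord (fix_res (gfst X) t * orbit_fun alpha X)) *
     fix_res (gfst (gtimes X)) (orbit_fun beta X)).
Proof.
apply: fix_ext => -[x h]; rewrite fix_valM fix_resE orbit_funE fix_trE.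
transitivity (\sum_(z | gfst X z == gfst X (x, h))
    j (tr (fix_val t z.1 * act z.2 alpha * act h beta)) * act z.2 beta).
  rewrite sum_gfst /= -[LHS]expand_beta; apply: eq_bigr => g _ /=.
  by rewrite mulrCA mulrA.
rewrite (pullback_big (pullback_gfst (gfst X))).
apply: eq_bigr => -[z k] /eqP[_ kh]; rewrite fix_valM fix_map_funE coordE.
by rewrite fix_valM !fix_resE !orbit_funE -kh.
Qed.

(* Expanding [t alpha_g] over the basis [alpha_h], and [t beta_h] over        *)
(* [beta_g], gives the same coefficients Tr(t alpha_g beta_h), which move     *)
(* across the tensor product.                                                 *)
Lemma sep_elt_mul X (t : TG X) : sep_elt X * l X t = sep_elt X * r X t.
Proof.
pose c := coord (fix_res (gfst X) t * orbit_fun alpha X) : KG _.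
have Pl : gres TG (gfst X) t * orbit_fun alpha X =
    gtr TG (gfst (gtimes X)) (phi _ c * orbit_fun alpha _).
  by apply/esym; exact: coordK.
have Pr : gres TG (gfst X) t * orbit_fun beta X =
    gtr TG (gtimes_map (gfst X))
      (phi _ c * gres TG (gfst _) (orbit_fun beta X)).
  exact: orbit_beta_res.
rewrite ![sep_elt X * _]mulrC /sep_elt -!gfrob -!tmap_res mulrA -rmorphM Pl.
rewrite mulrCA -rmorphM Pr !tmap_tr -[_ * r _ _]mulrC -!gfrob.
rewrite -!(ax_tr_comp (gmackeyP B)) gfst_map -!tmap_res !rmorphM tbox_compat.
rewrite -[gres TG (gtimes_map _) _]/(fix_res _ _) orbit_fun_res.
by apply: (congr1 (gtr B _)); rewrite [RHS]mulrC -mulrA [RHS]mulrCA.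
Qed.

(** On a generator, Frobenius moves s inside the transfer, where it restricts to s over U and
    carries the right factor to the left. *)
Lemma sep_elt_pairing X z :
  sep_elt X * box_pairing (@tbox_compat _ _ _ _ B) X z =
  sep_elt X * l X (box_mult phi X z).
Proof.
move: z; apply: relbox_ind => [|U f a b].
  split=> [|y z ey ez]; first by rewrite !raddf0 !mulr0.
  by rewrite !raddfB !mulrBr ey ez.
rewrite 2!relbox_liftE /pairing tmap_tr -!gfrob sep_elt_res rmorphM /=.
by apply: (congr1 (gtr B f)); rewrite mulrCA -sep_elt_mul mulrCA.
Qed.

Lemma aug_sep_elt X p :
  p \in @aug_ideal _ _ _ phi B X -> p = (1 - sep_elt X) * p.
Proof.
case/asboolP => z z0 <-; rewrite mulrBl mul1r sep_elt_pairing z0.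
by rewrite raddf0 mulr0 subr0.
Qed.

(** Multiplication sends s to sum_g g(alpha) g(beta), which is 1 by [orthogonality]. *)
Lemma sep_elt_aug X : 1 - sep_elt X \in @aug_ideal _ _ _ phi B X.
Proof.
apply/asboolP.
exists (relbox_gen (M := TK) (N := TK) (gid X) (1 : TG X) (1 : TG X) -
   relbox_gen (M := TK) (N := TK) (gfst X)
     (orbit_fun alpha X) (orbit_fun beta X)).
  rewrite raddfB /box_mult !box_pairing_gen /= (ax_tr_id (gmackeyP TG)).
  apply/eqP; rewrite subr_eq0 mulr1; apply/eqP/fix_ext => x.
  rewrite fix_val1 fix_trE sum_gfst.
  under eq_bigr do rewrite fix_valM !orbit_funE /= -[act _ beta]gring_act1.
  by rewrite orthogonality eqxx.
by rewrite raddfB !box_pairing_gen (ax_tr_id (gmackeyP B)) !rmorph1 mulr1.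
Qed.

End Kaehler.

Lemma fix_etale : tambara_etale phi.
Proof.
split; first exact: fix_flat.
split=> [|B X w]; first exact: inhabits fix_tambara_box.
apply: kaehler_eq0 => p Ip; exists (1 - sep_elt B X); first exact: sep_elt_aug.
by exists p => //; apply: aug_sep_elt.
Qed.

End NormalBasis.

(** * A normal basis of a quadratic extension and its dual *)

Section QuadraticExtension.
Variables (K : fieldType) (L : splittingFieldType K).
Variable c : {morphism [set: C2] >-> gal_of {:L}}.
Hypothesis LK_galois : galois 1 {:L}.
Hypothesis c_isom : isom [set: C2] 'Gal({:L} / 1) c.
Local Notation act := (gring_act (galois_gring c)).

Lemma C2_mulgC : commutative (@mulg C2).
Proof. exact: Zp_mulgC. Qed.

Lemma galois_fixedP (a : L) : (forall g, act g a = a) -> exists k : K, k%:A = a.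
Proof.
move=> fix_a; have : a \in fixedField 'Gal({:L} / 1)%g.
  apply/fixedFieldP; rewrite ?memvf // => s.
  have [_ <-] := isomP c_isom; case/morphimP => g _ _ ->; exact: fix_a.
have /galois_fixedField -> := LK_galois.
by case/vlineP => k ->; exists k.
Qed.

Lemma galois_trace_in_base (a : L) : exists k : K, k%:A = \sum_g act g a.
Proof.
apply: galois_fixedP => g; rewrite rmorph_sum.
rewrite [RHS](reindex_inj (mulIg g)); apply: eq_bigr => h _.
by rewrite gring_actM.
Qed.

Definition galois_tr (a : L) : K := sval (cid (galois_trace_in_base a)).
Lemma galois_trE a : (galois_tr a)%:A = \sum_g act g a :> L.
Proof. by rewrite /galois_tr; case: cid. Qed.

(** The group ['Z_2] is additive: [1%g] is its zero, and the ring unit [1%R] is the nontrivial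
    element. *)
Local Notation tau := (1%R : C2).

Lemma sum_C2 (V : nmodType) (F : C2 -> V) : \sum_g F g = F 1%g + F tau.
Proof. by rewrite big_ord_recl big_ord1; congr (F _ + F _); apply: val_inj. Qed.

Lemma galois_act_nontrivial : exists a : L, act tau a != a.
Proof.
case: (pselect (exists a : L, act tau a != a)) => // fix_all.
have/injmP c_inj := (isomP c_isom).1.
suff : tau = 1%g by [].
apply: c_inj; rewrite ?inE // morph1; apply/eqP/gal_eqP => a _.
rewrite gal_id; apply/eqP; apply: contra_notT fix_all => ca.
by exists a.
Qed.

Lemma tauK (a : L) : act tau (act tau a) = a.
Proof.
rewrite -gring_actM -[RHS](@gring_act1 _ (galois_gring c)).
by congr (act _ a); apply: val_inj.
Qed.

Lemma galois_normal_basis : exists a : L, act tau a ^+ 2 != a ^+ 2.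
Proof.
have [a ta] := galois_act_nontrivial.
have [ta2|] := eqVneq (act tau a ^+ 2) (a ^+ 2); last by exists a.
have taN : act tau a = - a.
  move/eqP: ta2; rewrite eqf_sqr (negPf ta) => /eqP //.
have aN : - a != a by rewrite -taN.
(* As tau(a) = -a, the squares of 1 - a and 1 + a agree only if -a = a or 1 = -1, and the latter
   implies the former. *)
exists (1 + a); rewrite rmorphD rmorph1 taN eqf_sqr negb_or.
rewrite (inj_eq (addrI 1)) aN /= opprD (inj_eq (addIr _)).
apply: contra aN => /eqP N1.
by rewrite -mulN1r -N1 mul1r.
Qed.

Lemma C2P (g : C2) : g = 1%g \/ g = tau.
Proof. by case: g => -[|[|//]] lt_g; [left|right]; apply: val_inj. Qed.

(** The matrix with rows (a, tau a) and (tau a, a) has determinant d = a^2 - tau(a)^2. Since tau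
    negates d, the entries a/d and -tau(a)/d of its inverse are conjugate. *)
Lemma galois_dual (a : L) :
  act tau a ^+ 2 != a ^+ 2 ->
  forall g h, galois_tr (act g a * act h (a / (a ^+ 2 - act tau a ^+ 2))) =
              (g == h)%:R.
Proof.
move=> ta2 g h; apply: (fmorph_inj (in_alg L)).
rewrite rmorph_nat [LHS]galois_trE sum_C2.
set t := act tau a; set d := _ - _.
have d0 : d != 0 by rewrite subr_eq0 eq_sym.
have tb : act tau (a / d) = - (t / d).
  by rewrite rmorphM fmorphV rmorphB !rmorphXn tauK -opprB invrN mulrN.
have ttb : act tau (- (t / d)) = a / d by rewrite -tb tauK.
have dd : a * (a / d) - t * (t / d) = 1.
  by rewrite !mulrA -!expr2 -mulrBl divff.
have ab : a * (t / d) = t * (a / d) by rewrite mulrCA.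
move: (a / d) (t / d) => b s in tb ttb dd ab *.
case: (C2P g) => ->; case: (C2P h) => ->;
  rewrite !(gring_act1, rmorphM) -/t ?tb ?ttb ?tauK ?eqxx mulrN.
- exact: dd.
- by rewrite ab addNr.
- by rewrite ab subrr.
- by rewrite addrC; exact: dd.
Qed.

End QuadraticExtension.

Theorem theorem3p1 (K : fieldType) (L : splittingFieldType K)
    (c : {morphism [set: C2] >-> gal_of {:L}})
    (LK_galois : galois 1 {:L})
    (c_isom : isom [set: C2] 'Gal({:L} / 1) c) :
  tambara_etale (const_to_fix c).
Proof.
have [a ta2] := galois_normal_basis c_isom.
(* K^c is the fixed point functor of the trivial action, so [const_to_fix c] is the [fix_map] given
   by [in_algJ c]. *)
apply: (fix_etale (T := galois_gring c) (j := in_alg L)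
  (tr := galois_tr LK_galois c_isom) (alpha := a)
  (beta := a / (a ^+ 2 - gring_act (galois_gring c) 1%R a ^+ 2)) (in_algJ c)).
- exact: fmorph_inj.
- exact: galois_trE.
- exact: galois_dual ta2.
- exact: C2_mulgC.
Qed.
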